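(* Let $\nu\in\mathbb{R}$ and let $H$ be the functional $$H(M,\rho)=\frac12\int_{\mathbb{R}^n}\frac{\|M\|^2}{\rho}\,dx+\frac{\nu^2}{2}\int_{\mathbb{R}^n}\langle M,\nabla\log\rho\rangle\,dx+\frac{\nu^4}{8}\int_{\mathbb{R}^n}\rho\,\|\nabla\log\rho\|^2\,dx .$$ Let $(M(t),\rho(t))$ be a smooth curve, with $M(t)=(m_1,\dots,m_n)$ a smooth covector-valued field on $\mathbb{R}^n$ and $\rho(t)>0$ a smooth density on $\mathbb{R}^n$. Fix a choice of sign (upper or lower throughout), and consider the deep learning dynamics $$\partial_t M=\{M,H\}_{\pm},\qquad \partial_t\rho=\{\rho,H\}_{\pm},$$ where $\{\cdot,\cdot\}_\pm$ is the bracket $$\{F,G\}_{\pm}(M,\rho)=\pm\left\langle M,\left[\frac{\delta F}{\delta M},\frac{\delta G}{\delta M}\right]\right\rangle\mp\left\langle\rho,\ \pounds_{\frac{\delta F}{\delta M}}\frac{\delta G}{\delta\rho}-\pounds_{\frac{\delta G}{\delta M}}\frac{\delta F}{\delta\rho}\right\rangle .$$ Then these dynamics can be written in the form $$\partial_t M=\pm\,\mathrm{ad}^{*}_{\frac{\delta H}{\delta M}}M\ \mp\ \frac{\delta H}{\delta\rho}\diamond\rho,\qquad \partial_t\rho=\mp\,\pounds_{\frac{\delta H}{\delta M}}\rho .$$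
   Context: Setting: $\mathbb{R}^n$ with coordinates $x^1,\dots,x^n$; repeated indices are summed. The pair $(M,\rho)$ consists of a momentum field $M=(m_1,\dots,m_n)$, paired with vector fields by $\langle M,u\rangle=\int m_i u^i\,dx$, and a density $\rho$, paired with functions by $\langle\rho,a\rangle=\int\rho\,a\,dx$. Functional derivatives: $\delta F/\delta M$ (a vector field) and $\delta F/\delta\rho$ (a function) are the variational derivatives with respect to the $L^2$ pairings above, computed with compactly supported smooth variations (i.e. the Euler–Lagrange derivatives of the integrand). Meaning of the dynamics: $\partial_t M=\{M,H\}_\pm$, $\partial_t\rho=\{\rho,H\}_\pm$ means that for every smooth compactly supported vector field $\varphi$ and function $\chi$, the linear functional $F(M,\rho)=\langle M,\varphi\rangle+\langle\rho,\chi\rangle$ (so $\delta F/\delta M=\varphi$, $\delta F/\delta\rho=\chi$) satisfies $\frac{d}{dt}F(M(t),\rho(t))=\{F,H\}_\pm(M(t),\rho(t))$ for all $t$. Notation in the bracket: for vector fields $u,w$, $[u,w]^i=u^j\partial_{x^j}w^i-w^j\partial_{x^j}u^i$, so that $\langle M,[u,w]\rangle=\int m_i\,(u^j\partial_{x^j}w^i-w^j\partial_{x^j}u^i)\,dx$. For a vector field $u$ and a function $a$, $\pounds_u a=u\cdot\nabla a$. For a vector field $u$ and a density $\rho$, $\pounds_u\rho=\mathrm{div}(\rho u)$. Coadjoint operator: $(\mathrm{ad}^*_u M)_i=\partial_{x^j}(m_i u^j)+m_j\,\partial_{x^i}u^j$. Diamond operator: for a function $a$ and a density $\rho$, $a\diamond\rho=\rho\,\nabla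 a$. *)

(* Defs.v *)
From HB Require Import structures.
From mathcomp Require Import all_boot all_order all_algebra.
From mathcomp Require Import all_classical all_reals all_analysis.

Set Implicit Arguments.
Unset Strict Implicit.
Unset Printing Implicit Defensive.

Import Order.TTheory GRing.Theory Num.Theory.
Import numFieldNormedType.Exports.

Local Open Scope classical_set_scope.
Local Open Scope ring_scope.

(* Points, vectors and covectors of R^n are row vectors 'rV[R]_n; |.| is the
   sup norm there, so Euclidean norms are always written with dot. *)

Section Smooth.
Context {R : realType}.

(* C^infinity on the open set U: all iterated directional derivatives exist and
   are Frechet differentiable (hence continuous) at every point of U. *)
Definition smooth_on (V W : normedModType R) (U : set V) (f : V -> W) : Prop :=
  forall (s : seq V) (x : V), U x ->
    differentiable (foldr (fun v (g : V -> W) => 'D_v g) f s) x.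

Definition smooth (V W : normedModType R) (f : V -> W) : Prop :=
  smooth_on setT f.

Definition test_fun (V W : normedModType R) (f : V -> W) : Prop :=
  smooth f /\ compact (closure [set x | f x != 0]).

End Smooth.

Section Integral.
Context {R : realType}.

(* n-fold product of the one-dimensional Lebesgue measure, on the product
   sigma-algebra of n.-tuple R *)
Fixpoint lebesgue_tuple (n : nat) :
    set (n.-tuple (measurableTypeR R)) -> \bar R :=
  match n with
  | 0%N => dirac [tuple]
  | m.+1 =>
      pushforward (product_measure1 (@lebesgue_measure R) (@lebesgue_tuple m))
        (fun xt : measurableTypeR R * m.-tuple (measurableTypeR R) =>
           [tuple of xt.1 :: xt.2])
  end.

Let cons_pair (n : nat)
    (xt : measurableTypeR R * n.-tuple (measurableTypeR R)) :
    n.+1.-tuple (measurableTypeR R) := [tuple of xt.1 :: xt.2].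

Let measurable_cons_pair (n : nat) : measurable_fun setT (@cons_pair n).
Proof.
by apply: measurable_cons; [exact: measurable_fst|exact: measurable_snd].
Qed.

Let lebesgue_tupleP (n : nat) :
  exists mu : {sigma_finite_measure set (n.-tuple (measurableTypeR R)) -> \bar R},
    @lebesgue_tuple n = mu :> (set _ -> \bar R).
Proof.
elim: n => [|n [mu muE]] /=; first by exists (dirac [tuple]).
pose nu := [the {measure set _ -> \bar R} of
  product_measure1 (@lebesgue_measure R) mu].
pose p := pushforward nu (@cons_pair n).
have p0 : p set0 = 0%E by rewrite /p /pushforward preimage_set0 measure0.
have p_ge0 A : (0 <= p A)%E by exact: (measure_ge0 nu).
have p_add : semi_sigma_additive p.
  move=> F mF tF mUF; rewrite /p /pushforward preimage_bigcup.
  apply: (@measure_semi_sigma_additive _ _ _ nu).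
  - by move=> i; rewrite -[X in measurable X]setTI; exact: measurable_cons_pair.
  - apply/trivIsetP => /= i j _ _ ij; rewrite -preimage_setI.
    by move/trivIsetP : tF => /(_ _ _ _ _ ij) ->//; rewrite preimage_set0.
  - rewrite -preimage_bigcup -[X in measurable X]setTI.
    exact: measurable_cons_pair.
pose uncons (t : n.+1.-tuple (measurableTypeR R)) :=
  (thead t : measurableTypeR R, [tuple of behead t]).
have consK : cancel (@cons_pair n) uncons.
  by move=> [x t]; rewrite /uncons /cons_pair theadE; congr pair; exact/val_inj.
have munc : measurable_fun setT uncons.
  apply: measurable_fun_pair; last exact: measurable_behead.
  exact: measurable_tnth.
have p_fin : sigma_finite setT p.
  have [F TF mF] : sigma_finite setT nu.
    have /sigma_finiteP[F [TF ndF Foo]] := sigma_finiteT (@lebesgue_measure R).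
    have /sigma_finiteP[G [TG ndG Goo]] := sigma_finiteT mu.
    exists (fun i => F i `*` G i).
      rewrite -setXTT TF TG predeqE => -[x y]; split.
        move=> [/= [i _ Fix] [k _ Gky]]; exists (maxn i k) => //; split.
        - by move: x Fix; exact/subsetPset/ndF/leq_maxl.
        - by move: y Gky; exact/subsetPset/ndG/leq_maxr.
      by move=> [i _ []/= ? ?]; split; exists i.
    move=> k; have [? ?] := Foo k; have [? ?] := Goo k.
    split; first exact: measurableX.
    by rewrite /nu /= product_measure1E// lte_mul_pinfty// ge0_fin_numE.
  exists (fun i => uncons @^-1` F i).
    by rewrite -preimage_bigcup -TF preimage_setT.
  move=> i; have [mFi nuFi] := mF i; split.
    by rewrite -[X in measurable X]setTI; exact: munc.
  rewrite /p /pushforward -comp_preimage (_ : uncons \o _ = id)//.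
  exact/funext/consK.
have pE : p = pushforward nu (@cons_pair n) by [].
clearbody p.
pose pM : {measure set _ -> \bar R} :=
  HB.pack p (isMeasure.Build _ _ _ p p0 p_ge0 p_add).
pose pS : {sigma_finite_measure set _ -> \bar R} :=
  HB.pack p pM (Measure_isSigmaFinite.Build _ _ _ pM p_fin).
by exists pS; rewrite muE -[RHS]/p pE.
Qed.

Let lebesgue_tuple0 n : @lebesgue_tuple n set0 = 0%E.
Proof. by have [mu ->] := lebesgue_tupleP n. Qed.

Let lebesgue_tuple_ge0 n A : (0 <= @lebesgue_tuple n A)%E.
Proof. by have [mu ->] := lebesgue_tupleP n. Qed.

Let lebesgue_tuple_sigma_additive n : semi_sigma_additive (@lebesgue_tuple n).
Proof.
by have [mu ->] := lebesgue_tupleP n; exact: measure_semi_sigma_additive.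
Qed.

HB.instance Definition _ n := isMeasure.Build _ _ _ (@lebesgue_tuple n)
  (lebesgue_tuple0 n) (@lebesgue_tuple_ge0 n)
  (@lebesgue_tuple_sigma_additive n).

Let lebesgue_tuple_sigma_finite n : sigma_finite setT (@lebesgue_tuple n).
Proof. by have [mu ->] := lebesgue_tupleP n; exact: sigma_finiteT. Qed.

HB.instance Definition _ n := Measure_isSigmaFinite.Build _ _ _
  (@lebesgue_tuple n) (@lebesgue_tuple_sigma_finite n).

Definition integralRn (n : nat) (f : 'rV[R]_n -> R) : R :=
  Rintegral (@lebesgue_tuple n) setT (fun t => f (\row_i tnth t i)).

End Integral.

Section VectorCalculus.
Context {R : realType} {n : nat}.
Implicit Types (u w M : 'rV[R]_n -> 'rV[R]_n) (a rho : 'rV[R]_n -> R).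

Definition dot (v w : 'rV[R]_n) : R := \sum_(i < n) v 0 i * w 0 i.

Definition partial (i : 'I_n) a : 'rV[R]_n -> R := 'D_(delta_mx 0 i) a.

Definition grad a (x : 'rV[R]_n) : 'rV[R]_n := \row_i partial i a x.

Definition lie_bracket u w (x : 'rV[R]_n) : 'rV[R]_n :=
  \row_i \sum_(j < n) (u x 0 j * partial j (fun y => w y 0 i) x
                       - w x 0 j * partial j (fun y => u y 0 i) x).

Definition lie_fun u a (x : 'rV[R]_n) : R := dot (u x) (grad a x).

Definition lie_dens u rho (x : 'rV[R]_n) : R :=
  \sum_(j < n) partial j (fun y => rho y * u y 0 j) x.

Definition ad_star u M (x : 'rV[R]_n) : 'rV[R]_n :=
  \row_i (\sum_(j < n) partial j (fun y => M y 0 i * u y 0 j) x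
          + \sum_(j < n) M x 0 j * partial i (fun y => u y 0 j) x).

Definition diamond a rho (x : 'rV[R]_n) : 'rV[R]_n := rho x *: grad a x.

End VectorCalculus.

Section Functionals.
Context {R : realType} {n : nat}.
Implicit Types (M : 'rV[R]_n -> 'rV[R]_n) (rho : 'rV[R]_n -> R).

(* A functional is given by its integrand: F M rho x is the integrand of
   F(M, rho) at x. The integral itself may diverge (e.g. for the Hamiltonian of
   fields that do not decay), but the difference of the integrands before and
   after a compactly supported variation is compactly supported. *)
Definition functional : Type :=
  ('rV[R]_n -> 'rV[R]_n) -> ('rV[R]_n -> R) -> 'rV[R]_n -> R.

Implicit Types F G : functional.

Definition evalF F M rho : R := integralRn (F M rho).

Definition is_derivM F M rho (u : 'rV[R]_n -> 'rV[R]_n) : Prop :=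
  smooth u /\
  forall phi : 'rV[R]_n -> 'rV[R]_n, test_fun phi ->
    is_derive (0 : R) (1 : R)
      (fun e : R => integralRn (fun x =>
         F (fun y => M y + e *: phi y) rho x - F M rho x))
      (integralRn (fun x => dot (phi x) (u x))).

Definition is_derivrho F M rho (a : 'rV[R]_n -> R) : Prop :=
  smooth a /\
  forall chi : 'rV[R]_n -> R, test_fun chi ->
    is_derive (0 : R) (1 : R)
      (fun e : R => integralRn (fun x =>
         F M (fun y => rho y + e * chi y) x - F M rho x))
      (integralRn (fun x => chi x * a x)).

(* Such u and a are unique when they exist, by the fundamental lemma of the
   calculus of variations. *)
Definition derivM F M rho : 'rV[R]_n -> 'rV[R]_n := get (is_derivM F M rho).
Definition derivrho F M rho : 'rV[R]_n -> R := get (is_derivrho F M rho).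

(* The sign +- of the upper/lower choice; -+ is its opposite. *)
Definition pm (upper : bool) : R := if upper then 1 else -1.

Definition bracket (upper : bool) F G M rho : R :=
  pm upper * integralRn (fun x =>
    dot (M x) (lie_bracket (derivM F M rho) (derivM G M rho) x))
  - pm upper * integralRn (fun x =>
    rho x * (lie_fun (derivM F M rho) (derivrho G M rho) x
             - lie_fun (derivM G M rho) (derivrho F M rho) x)).

Definition linear_functional (phi : 'rV[R]_n -> 'rV[R]_n)
    (chi : 'rV[R]_n -> R) : functional :=
  fun M rho x => dot (M x) (phi x) + rho x * chi x.

Definition hamiltonian (nu : R) : functional := fun M rho x =>
  let grad_log := grad (fun y => ln (rho y)) x in
  2^-1 * (dot (M x) (M x) / rho x)
  + nu ^+ 2 / 2 * dot (M x) grad_log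
  + nu ^+ 4 / 8 * (rho x * dot grad_log grad_log).

(* d_t M = {M, H} and d_t rho = {rho, H} for all t in J, tested against all
   linear functionals with test-function coefficients *)
Definition bracket_dynamics (upper : bool) (H : functional) (J : set R)
    (M : R -> 'rV[R]_n -> 'rV[R]_n) (rho : R -> 'rV[R]_n -> R) : Prop :=
  forall (phi : 'rV[R]_n -> 'rV[R]_n) (chi : 'rV[R]_n -> R),
    test_fun phi -> test_fun chi ->
    forall t : R, J t ->
      is_derive t (1 : R)
        (fun s : R => evalF (linear_functional phi chi) (M s) (rho s))
        (bracket upper (linear_functional phi chi) H (M t) (rho t)).

Definition lie_poisson_form (upper : bool) (H : functional) (J : set R)
    (M : R -> 'rV[R]_n -> 'rV[R]_n) (rho : R -> 'rV[R]_n -> R) : Prop :=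
  forall t : R, J t -> forall x : 'rV[R]_n,
    is_derive t (1 : R) (fun s : R => M s x)
      (pm upper *: ad_star (derivM H (M t) (rho t)) (M t) x
       - pm upper *: diamond (derivrho H (M t) (rho t)) (rho t) x)
    /\
    is_derive t (1 : R) (fun s : R => rho s x)
      (- pm upper * lie_dens (derivM H (M t) (rho t)) (rho t) x).

End Functionals.

(* Main.v *)
(* Testing the dynamics against the linear functional with coefficients
   [phi, chi], whose variational derivatives are [phi] and [chi], and
   integrating by parts turns the bracket into the integral of
   [phi . A + chi * B], where [A] and [B] are the right-hand sides of the
   Lie-Poisson equations. Differentiating under the integral sign, the time
   derivative of the functional is the integral of
   [phi . d_t M + chi * d_t rho]. The fundamental lemma of the calculus of
   variations identifies the two.

   The only property of [H] that matters is that its variational derivatives are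
   smooth. Integration by parts comes from translation invariance: the integral
   of [f (h *: v + x)] does not depend on [h], and its derivative at [h = 0] is
   the integral of ['D_v f]. *)

Require Import Defs.
From mathcomp Require Import all_boot all_order all_algebra.
From mathcomp Require Import all_classical all_reals all_analysis.
From mathcomp Require Import measurable_realfun ring lra.

Set Implicit Arguments.
Unset Strict Implicit.
Unset Printing Implicit Defensive.

Import Order.TTheory GRing.Theory Num.Theory.
Import numFieldNormedType.Exports.
Local Open Scope classical_set_scope.
Local Open Scope ring_scope.

(** * Product Lebesgue measure *)

(** Two obstacles shape the proof. The fields [M t] and [rho t] are not assumed to decay, so only
    integrands carrying a test function are known to be integrable. Supports are therefore tracked
    by an explicit sup-norm radius: a continuous integrand is dominated by a constant times the
    indicator of a box, and a single box serves for all nearby times or translates. Moreover, the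
    measure lives on tuples with the product sigma-algebra while calculus lives on row vectors, so
    translation invariance and the measurability of continuous functions are both transported along
    [row_of_tuple].

    The fundamental lemma needs test functions in the sense of [smooth], that is, all iterated
    directional derivatives of a bump must be controlled at once; an algebra of functions stable
    under every ['D_v] does this. Finally, [derivM] and [derivrho] are selected by [get]: uniqueness
    of variational derivatives is what computes them on linear functionals, while for [H] the
    smoothness of the selected value is enough. *)

Section LebesgueTuple.
Context {R : realType}.
Local Notation mu n := (@lebesgue_tuple R n).
Local Notation tupleR n := (n.-tuple (measurableTypeR R)).

Definition row_of_tuple n (t : tupleR n) : 'rV[R]_n := \row_i tnth t i.

Definition tuple_shift n (v : 'rV[R]_n) (t : tupleR n) : tupleR n :=
  [tuple v 0 i + tnth t i | i < n].

Lemma row_of_tuple_shift n (v : 'rV[R]_n) (t : tupleR n) :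
  row_of_tuple (tuple_shift v t) = v + row_of_tuple t.
Proof. by apply/rowP => i; rewrite !mxE tnth_mktuple. Qed.

Lemma measurable_tuple_shift n (v : 'rV[R]_n) :
  measurable_fun setT (tuple_shift v).
Proof.
apply/measurable_fun_tnthP => i.
rewrite (_ : _ \o _ = (fun t : tupleR n => v 0 i + tnth t i)); last first.
  by apply/funext => t /=; rewrite tnth_mktuple.
by apply: measurable_funD => //; exact: measurable_tnth.
Qed.

Lemma tuple_shift_cons n (v : 'rV[R]_n.+1) x (t : tupleR n) :
  tuple_shift v [tuple of x :: t] =
  [tuple of (v 0 ord0 + x) :: tuple_shift (\row_i v 0 (lift ord0 i)) t].
Proof.
apply: eq_from_tnth => i; rewrite tnth_mktuple.
case: (unliftP ord0 i) => [j ->|->]; last by rewrite !tnth0.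
by rewrite !tnthS tnth_mktuple mxE.
Qed.

(** The push-forward by a translation gives half-open intervals their length, and this characterises
    Lebesgue measure. *)
Lemma lebesgue_measure_shift (a : R) (A : set (measurableTypeR R)) :
  measurable A ->
  lebesgue_measure ((fun x => a + x) @^-1` A) = lebesgue_measure A.
Proof.
move=> mA.
have ma : measurable_fun setT
    ((fun x => a + x) : measurableTypeR R -> measurableTypeR R).
  by apply: measurable_funD.
pose nu := [the {measure set _ -> \bar R} of
  pushforward lebesgue_measure ((fun x => a + x) :
    measurableTypeR R -> measurableTypeR R)].
apply/esym; rewrite -[RHS]/(nu ma A).
apply: (@lebesgue_measure_unique R (nu ma)) => //= _ [[b c]] _ <-.
rewrite /nu/= /pushforward.
rewrite (_ : _ @^-1` _ = `](b - a), (c - a)]%classic); last first.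
  by apply/seteqP; split => x /=; rewrite !in_itv/= ltrBlDl lerBrDl.
rewrite !lebesgue_measure_itv/= !lte_fin ltrD2r.
by case: ifP => // _; rewrite -!EFinD opprB addrA subrK.
Qed.


(** Induction on [n]: through [cons], a shift is the product of a shift of the head and a shift of
    the tail. It preserves the measure of rectangles, hence the product measure by uniqueness. *)
Lemma lebesgue_tuple_shift n (v : 'rV[R]_n) (A : set (tupleR n)) :
  measurable A -> mu n (tuple_shift v @^-1` A) = mu n A.
Proof.
elim: n => [|n IH] in v A *.
  move=> _; congr (mu 0 _); apply/seteqP.
  have e t : tuple_shift v t = t by apply: eq_from_tnth; case.
  by split=> t /=; rewrite e.
move=> mA; pose w : 'rV[R]_n := \row_i v 0 (lift ord0 i).
pose s := fun p : measurableTypeR R * tupleR n =>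
  ((v 0 ord0 + p.1 : measurableTypeR R), tuple_shift w p.2).
have ms : measurable_fun setT s.
  apply: measurable_fun_pair; first by apply: measurable_funD.
  by apply: measurableT_comp => //; exact: measurable_tuple_shift.
pose c := fun xt : measurableTypeR R * tupleR n => [tuple of xt.1 :: xt.2].
have mc : measurable_fun setT c.
  by apply: measurable_cons; [exact: measurable_fst|exact: measurable_snd].
rewrite /= /pushforward -/c.
have -> : c @^-1` (tuple_shift v @^-1` A) = s @^-1` (c @^-1` A).
  by apply/seteqP; split => p /=; rewrite /c/= tuple_shift_cons.
pose p := [the {measure set _ -> \bar R} of
  product_measure1 (@lebesgue_measure R) (@lebesgue_tuple R n)].
pose ps := [the {measure set _ -> \bar R} of pushforward p s].
apply/esym; apply: (product_measure_unique (m' := ps ms)); last first.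
  by rewrite -[X in measurable X]setTI; exact: mc.
move=> B C mB mC; rewrite /ps/= /pushforward.
rewrite (_ : s @^-1` (B `*` C) = ((fun x => v 0 ord0 + x) @^-1` B) `*`
  (tuple_shift w @^-1` C)); last by [].
rewrite /p/= product_measure1E.
- by congr (_ * _)%E; [exact: lebesgue_measure_shift|exact: IH].
- rewrite -[X in measurable X]setTI.
  have m1 : measurable_fun setT ((fun x => v 0 ord0 + x)
    : measurableTypeR R -> measurableTypeR R) by apply: measurable_funD.
  exact: m1.
- by rewrite -[X in measurable X]setTI; exact: measurable_tuple_shift.
Qed.

(** The sup-norm ball seen on tuples; its indicator is the dominating function of all later
    estimates. *)
Definition row_box n (K : R) : set (tupleR n) :=
  [set t | forall i, `|tnth t i| <= K].

Arguments row_box : clear implicits.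

Lemma row_boxS n (K : R) : row_box n.+1 K =
  [set t | `|thead t| <= K /\ row_box n K [tuple of behead t]].
Proof.
apply/seteqP; split => t /=.
  move=> h; split; first exact: h.
  by move=> i; rewrite tnth_behead; exact: h.
move=> [h0 h] i; case: (unliftP ord0 i) => [j ->|->//].
by have := h j; rewrite tnth_behead/= (_ : inord _ = lift ord0 j)//;
  apply/val_inj; rewrite /= inordK// ltnS ltn_ord.
Qed.

Lemma measurable_row_box n K : measurable (row_box n K).
Proof.
rewrite (_ : row_box n K = \bigcap_(i in [set: 'I_n])
    ((fun t => tnth t i) @^-1` `[-K, K])); last first.
  apply/seteqP; split => t /= h i; first by rewrite /= in_itv/= -ler_norml.
  by have := h i Logic.I; rewrite /= in_itv/= -ler_norml.
apply: fin_bigcap_measurable => // i _.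
by rewrite -[X in measurable X]setTI; apply: measurable_tnth.
Qed.

Lemma lebesgue_tuple_box n K : 0 <= K ->
  mu n (row_box n K) = ((2 * K) ^+ n)%:E.
Proof.
move=> K0; elim: n => [|n IH] /=.
  rewrite expr0 diracE mem_set//; by case.
rewrite /pushforward row_boxS.
rewrite (_ : _ @^-1` _ = `[-K, K]%classic `*` row_box n K); last first.
  apply/seteqP; split => -[x t] /=; rewrite theadE in_itv/= -ler_norml => -[h1 h2];
  split => //; move: h2; rewrite (_ : [tuple of _] = t)//; exact/val_inj.
rewrite product_measure1E//; last exact: measurable_row_box.
rewrite [X in (_ * X)%E]IH exprS.
rewrite [X in (X * _)%E](lebesgue_measure_itv `[-K, K]) /= lte_fin.
case: ltP => h; first by rewrite EFinM opprK -EFinD mulr_natl mulr2n.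
(* The interval degenerates to a point; both sides vanish because the exponent is a successor. *)
have -> : K = 0 by lra.
by rewrite !(mul0e,mulr0,mul0r).
Qed.

End LebesgueTuple.
Arguments row_box {R} n K.

(** * Integration of compactly supported continuous functions *)

Section Integration.
Context {R : realType} {n : nat}.
Local Notation mu := (@lebesgue_tuple R n).
Local Notation tupleR := (n.-tuple (measurableTypeR R)).
Implicit Types f g : 'rV[R]_n -> R.

Lemma rV_norm_le (x : 'rV[R]_n) (e : R) : 0 <= e ->
  (`|x| <= e) <-> (forall i, `|x 0 i| <= e).
Proof.
move=> e0; rewrite {1}/Num.norm/= mx_normrE; split=> [h i|h].
  by apply: le_trans h; exact: (le_bigmax _ (fun i => `|x i.1 i.2|) (0, i)).
by apply: bigmax_le => // -[i j] _ /=; rewrite ord1.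
Qed.

Lemma rV_coord_le (x : 'rV[R]_n) i : `|x 0 i| <= `|x|.
Proof. by apply: (rV_norm_le x _).1. Qed.

Let cell (k : nat) (t : tupleR) : n.-tuple int :=
  [tuple Num.floor (k.+1%:R * tnth t i) | i < n].

Let measurable_cell k w : measurable (cell k @^-1` [set w]).
Proof.
rewrite (_ : _ @^-1` _ = \bigcap_(i in [set: 'I_n])
  ((fun t => tnth t i) @^-1`
     `[(tnth w i)%:~R / k.+1%:R, ((tnth w i) + 1)%:~R / k.+1%:R[)).
  apply: fin_bigcap_measurable => // i _.
  by rewrite -[X in measurable X]setTI; apply: measurable_tnth.
apply/seteqP; split=> t /=.
  move=> <- i _; rewrite /= in_itv/= tnth_mktuple.
  rewrite ler_pdivrMr// ltr_pdivlMr// ![_ * k.+1%:R]mulrC.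
  exact: floor_itv.
move=> h; apply: eq_from_tnth => i; rewrite tnth_mktuple.
have := h i Logic.I; rewrite /= in_itv/= ler_pdivrMr// ltr_pdivlMr//.
rewrite ![_ * k.+1%:R]mulrC => hi; exact: floor_def.
Qed.

(* [f] is the pointwise limit of its values at the lower corners of the cells of
   mesh [1/(k+1)], each of which is a function of countably many values. *)
Lemma measurable_continuous_rV f : continuous f ->
  measurable_fun setT (f \o @row_of_tuple R n).
Proof.
move=> cf; pose corner k (w : n.-tuple int) : 'rV[R]_n :=
  \row_i ((tnth w i)%:~R / k.+1%:R).
apply: (@measurable_fun_cvg _ _ _ _ (fun k t => f (corner k (cell k t)))).
- move=> k _ Y mY; rewrite setTI.
  (* The preimage of [Y] is a countable union of cells, namely those whose corner value lies in
     [Y]. *)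
  rewrite (_ : _ @^-1` _ = \bigcup_(w : n.-tuple int)
    (cell k @^-1` [set w] `&` [set _ | Y (f (corner k w))])).
    apply: countable_bigcupT_measurable => // w.
    have [Yw|nYw] := pselect (Y (f (corner k w))).
      rewrite (_ : _ `&` _ = cell k @^-1` [set w]); first exact: measurable_cell.
      by apply/seteqP; split => t //= -[].
    rewrite (_ : _ `&` _ = set0); first exact: measurable0.
    by apply/seteqP; split => t //= -[].
  apply/seteqP; split => t /=; first by exists (cell k t).
  by move=> [w _ [/= -> ]].
- move=> t _; apply: (cvg_comp (fun k => corner k (cell k t)) f);
    last exact: cf.
  apply/cvgrPdist_le => e e0.
  near=> k; apply/rV_norm_le => [|i]; first exact: ltW.
  rewrite !mxE tnth_mktuple.
  have /andP[h1 h2] := floor_itv (k.+1%:R * tnth t i).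
  rewrite intrD in h2.
  have k0 : (0 : R) < k.+1%:R by rewrite ltr0n.
  (* Rounding down [k.+1 * t_i] costs at most 1, so the corner is within [1/(k+1)] of the point in
     each coordinate. *)
  rewrite -[X in X - _](mulKf (lt0r_neq0 k0)) mulrC -mulrBl.
  rewrite normrM ger0_norm ?subr_ge0// gtr0_norm ?invr_gt0//.
  apply: (@le_trans _ _ (1 * k.+1%:R^-1)).
    by rewrite ler_pM2r ?invr_gt0//; rewrite lerBlDl ltW.
  by rewrite mul1r; apply: ltW; near: k; exact: (near_infty_natSinv_lt (PosNum e0)).
Unshelve. all: by end_near. Qed.

(** A radius instead of a compact closure: it is easy to follow through shifts, products and
    derivatives, and it matches [row_box]. *)
Definition supported_in (W : zmodType) (K : R) (f : 'rV[R]_n -> W) :=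
  forall x, K < `|x| -> f x = 0.

Lemma lt_norm_shift (K : R) (v x : 'rV[R]_n) : K + `|v| < `|x| -> K < `|v + x|.
Proof.
have := ler_normD (v + x) (- v); rewrite addrAC subrr add0r normrN => h1 h2.
by rewrite -(ltrD2r `|v|) (lt_le_trans h2).
Qed.

Lemma integrable_box (C K : R) : 0 <= K ->
  mu.-integrable setT (fun t => (C * \1_(row_box n K) t)%:E).
Proof.
move=> K0; under eq_fun do rewrite EFinM.
apply: integrableZl => //.
apply/integrableP; split.
  by apply/measurable_EFinP; apply: measurable_indic; exact: measurable_row_box.
rewrite (eq_integral (fun t => (\1_(row_box n K) t)%:E)); last first.
  by move=> t _; rewrite gee0_abs ?lee_fin.
rewrite integral_indic//; last exact: measurable_row_box.
by rewrite setIT [X in (X < _)%E]lebesgue_tuple_box// ltry.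
Qed.

Lemma box_bound (W : normedModType R) (K C : R) (f : 'rV[R]_n -> W) :
  0 <= K -> supported_in K f -> (forall x, `|x| <= K -> `|f x| <= C) ->
  forall t, `|f (row_of_tuple t)| <= C * \1_(row_box n K) t.
Proof.
move=> K0 fK fC t.
have C0 : 0 <= C by apply: le_trans (fC 0 _); rewrite ?normr0.
rewrite indicE.
have [tK|Kt] := leP `|row_of_tuple t| K.
  rewrite mem_set ?mulr1 ?fC// => i.
  by have := le_trans (rV_coord_le _ i) tK; rewrite mxE.
by rewrite fK// normr0 mulr_ge0.
Qed.

Lemma compact_ball0 (K : R) : compact [set x : 'rV[R]_n | `|x| <= K].
Proof.
apply: bounded_closed_compact.
  exists K; split; first exact: num_real.
  by move=> M KM x /= xK; rewrite (le_trans xK)// ltW.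
rewrite (_ : [set _ | _] = (fun x : 'rV[R]_n => `|x|) @^-1` [set r | r <= K])//.
by apply: closed_comp => [x _|]; [exact: norm_continuous|exact: closed_le].
Qed.

Lemma integrable_continuous_supported K f : continuous f -> supported_in K f ->
  mu.-integrable setT (fun t => (f (row_of_tuple t))%:E).
Proof.
move=> cf fK.
(* The radius [K] may be negative, hence the maximum with 0. Boundedness only provides bounds
   strictly above [C], hence [C + 1] below. *)
have [C [_ fC]] : bounded_set (f @` [set x | `|x| <= Num.max K 0]).
  apply: compact_bounded; apply: continuous_compact;
    [exact: continuous_subspaceT|exact: compact_ball0].
have K0 : 0 <= Num.max K 0 by rewrite le_max lexx orbT.
have fK' : supported_in (Num.max K 0) f.
  by move=> x; rewrite gt_max => /andP[/fK].
apply: (le_integrable _ _ _ (integrable_box (C + 1) K0)) => //.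
  apply/measurable_EFinP; exact: measurable_continuous_rV.
move=> t _ /=; rewrite lee_fin.
apply: (@le_trans _ _ ((C + 1) * \1_(row_box n (Num.max K 0)) t)).
  by apply: (box_bound (C := C + 1)) => // x xK; apply: (fC (C + 1));
    [rewrite ltrDl|exists x].
exact: ler_norm.
Qed.

Lemma integralRnE f :
  integralRn f = Rintegral mu setT (fun t => f (row_of_tuple t)).
Proof. by []. Qed.

Lemma integralRnD K f g : continuous f -> continuous g ->
  supported_in K f -> supported_in K g ->
  integralRn (fun x => f x + g x) = integralRn f + integralRn g.
Proof.
move=> cf cg fK gK; rewrite !integralRnE RintegralD//.
  exact: (integrable_continuous_supported cf fK).
exact: (integrable_continuous_supported cg gK).
Qed.

Lemma integralRnZ K a f : continuous f -> supported_in K f ->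
  integralRn (fun x => a * f x) = a * integralRn f.
Proof.
move=> cf fK; rewrite !integralRnE RintegralZl//.
exact: (integrable_continuous_supported cf fK).
Qed.

(** The left side is an integral against the push-forward of the measure by [tuple_shift v], which
    is the measure itself. *)
Lemma integralRn_shift K f (v : 'rV[R]_n) : continuous f -> supported_in K f ->
  integralRn (fun x => f (v + x)) = integralRn f.
Proof.
move=> cf fK; rewrite /integralRn /Rintegral; congr fine.
have ms := measurable_tuple_shift v.
transitivity (\int[mu]_(t in tuple_shift v @^-1` setT)
   ((fun t => (f (row_of_tuple t))%:E) \o tuple_shift v) t)%E.
  rewrite preimage_setT; apply: eq_integral => t _ /=.
  by rewrite row_of_tuple_shift.
have cfv : continuous (fun x => f (v + x)).
  move=> x; apply: (@continuous_comp _ _ _ (fun x => v + x) f); last exact: cf.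
  apply: (@cvgD _ _ _ (nbhs x) _ (fun=> v) id v x); [exact: cvg_cst|exact: cvg_id].
rewrite -integral_pushforward//.
- apply: eq_measure_integral => A mA _; exact: lebesgue_tuple_shift.
- apply/measurable_EFinP; exact: measurable_continuous_rV.
- rewrite preimage_setT.
  rewrite (_ : _ \o _ = fun t => (f (v + row_of_tuple t))%:E); last first.
    by apply/funext => t /=; rewrite row_of_tuple_shift.
  apply: (@integrable_continuous_supported (K + `|v|) _ cfv) => x Kx.
  exact/fK/lt_norm_shift.
Qed.

End Integration.

(** * Differentiation under the integral sign and vanishing of integrated derivatives *)

Section DiffUnder.
Context {R : realType} {n : nat}.
Local Notation mu := (@lebesgue_tuple R n).
Implicit Types f g : 'rV[R]_n -> R.

(** Dominated differentiation: [g'] is jointly continuous, hence bounded on the compact product of a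
    time interval and a ball, and the common support radius turns this bound into an integrable
    one. *)
Lemma is_derive_integralRn (g g' : R -> 'rV[R]_n -> R) (t0 e K : R) : 0 < e ->
  (forall t, `|t - t0| < e -> continuous (g t)) ->
  (forall t, `|t - t0| < e -> supported_in K (g t)) ->
  (forall t x, `|t - t0| < e -> is_derive t (1 : R) (g ^~ x) (g' t x)) ->
  (forall t x, `|t - t0| < e ->
    {for (t, x), continuous (fun p : R^o * 'rV[R]_n => g' p.1 p.2)}) ->
  is_derive t0 (1 : R) (fun t => integralRn (g t)) (integralRn (g' t0)).
Proof.
move=> e0 cg gK dg cg'.
pose L := Num.max K 0; have L0 : 0 <= L by rewrite le_max lexx orbT.
have gL t : `|t - t0| < e -> supported_in L (g t).
  by move=> te x; rewrite gt_max => /andP[Kx _]; exact: gK.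
(* Outside the ball, [g s x] vanishes for all [s] near [t], so its time derivative vanishes too. *)
have g'L t : `|t - t0| < e -> supported_in L (g' t).
  move=> te x Lx; have [_ <-] := dg t x te.
  rewrite (near_eq_derive (g := cst 0)) ?derive_cst//.
  near=> s; rewrite (gL s)//; near: s.
  have /= := @nbhsx_ballx R _ t (e - `|t - t0|).
  rewrite subr_gt0 => /(_ te); apply: filterS => s.
  rewrite /ball/= => h; rewrite -(subrK t s) -addrA.
  by rewrite (le_lt_trans (ler_normD _ _))// -ltrBrDr distrC.
have e20 : 0 < e / 2 by rewrite divr_gt0.
have e2e : e / 2 < e by rewrite ltr_pdivrMr// mulr2n mulrDr mulr1 ltrDl.
(* Halving [e] leaves a closed time interval, so that [A] is compact and still lies where the
   hypotheses hold. *)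
pose A : set (R^o * 'rV[R]_n) :=
  `[t0 - e / 2, t0 + e / 2]%classic `*` [set x | `|x| <= L].
have Ae p : A p -> `|p.1 - t0| < e.
  move=> [/= + _]; rewrite in_itv/= => h.
  by apply: le_lt_trans e2e; rewrite ler_distl.
have cA : compact A.
  by apply: compact_setX; [exact: segment_compact|exact: compact_ball0].
have [C [_ HC]] : bounded_set ((fun p => g' p.1 p.2 : R^o) @` A).
  apply: compact_bounded; apply: continuous_compact => //.
  apply: continuous_in_subspaceT => -[t x] /set_mem tx; apply: cg'.
  exact: (Ae _ tx).
have {}HC t x : `|t - t0| <= e / 2 -> `|x| <= L -> `|g' t x| <= C + 1.
  move=> te xL; apply: (HC (C + 1)); first by rewrite ltrDl.
  by exists (t, x) => //; split => //=; rewrite in_itv/= -ler_distl.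
have near_t0 t : t \in `]t0 - e / 2, t0 + e / 2[ -> `|t - t0| < e / 2.
  by rewrite in_itv/= -ltr_distl.
have near_t0' t : t \in `]t0 - e / 2, t0 + e / 2[ -> `|t - t0| < e.
  by move=> /near_t0 h; exact: lt_trans e2e.
pose F t (y : n.-tuple (measurableTypeR R)) := g t (row_of_tuple y).
pose G (y : n.-tuple (measurableTypeR R)) := (C + 1) * \1_(row_box n L) y.
have C0 : 0 <= C + 1.
  by apply: le_trans (HC t0 0 _ _); rewrite ?subrr ?normr0// ltW.
have Ft0 : t0 \in `]t0 - e / 2, t0 + e / 2[.
  by rewrite in_itv/= -ltr_distl subrr normr0.
have H1 t : t \in `]t0 - e / 2, t0 + e / 2[ ->
    mu.-integrable setT (EFin \o F t).
  move=> /near_t0' te.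
  exact: (integrable_continuous_supported (cg _ te) (gL _ te)).
have H2 t y : t \in `]t0 - e / 2, t0 + e / 2[ -> setT y ->
    derivable (F ^~ y) t 1.
  by move=> /near_t0' te _; have [] := dg t (row_of_tuple y) te.
have H3 t y : t \in `]t0 - e / 2, t0 + e / 2[ ->
    partial1of2 F t y = g' t (row_of_tuple y).
  move=> /near_t0' te; have [_ <-] := dg t (row_of_tuple y) te.
  by rewrite partial1of2E.
have H4 t y : t \in `]t0 - e / 2, t0 + e / 2[ -> setT y ->
    `|partial1of2 F t y| <= G y.
  move=> te _; rewrite H3//; apply: box_bound => //.
    exact/g'L/near_t0'.
  by move=> x xL; apply: HC => //; apply/ltW/near_t0.
have G0 y : 0 <= G y by rewrite mulr_ge0.
have iG : mu.-integrable setT (EFin \o G) by exact: integrable_box.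
split.
  exact: (derivable_under_integral measurableT Ft0 H1 H2 G0 iG H4).
rewrite -derive1E.
rewrite (differentiation_under_integral measurableT Ft0 H1 H2 G0 iG H4).
by rewrite integralRnE; apply: eq_Rintegral => y _; rewrite /= H3.
Unshelve. all: by end_near. Qed.

Lemma is_derive_line (W : normedModType R) (f : 'rV[R]_n -> W) v x t :
  derivable f (t *: v + x) v ->
  is_derive t (1 : R) (fun s : R => f (s *: v + x)) ('D_v f (t *: v + x)).
Proof.
have E : (fun h : R => h^-1 *: (((fun s : R => f (s *: v + x)) \o shift t)
    (h *: 1) - f (t *: v + x))) =
  (fun h => h^-1 *: ((f \o shift (t *: v + x)) (h *: v) - f (t *: v + x))).
  by apply/funext => h; rewrite /= scalerDl addrA [h *: 1]mulr1.
by move=> df; split; rewrite /derivable /derive E.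
Qed.

Lemma integralRn_derive f v K : continuous f -> supported_in K f ->
  (forall x, derivable f x v) -> continuous ('D_v f) ->
  integralRn ('D_v f) = 0.
Proof.
move=> cf fK df cdf.
have cline (g : 'rV[R]_n -> R) : continuous g ->
    continuous (fun p : R^o * 'rV[R]_n => g (p.1 *: v + p.2)).
  move=> cg p; apply: (cvg_comp (fun p : R^o * 'rV[R]_n => (p.1 : R) *: v + p.2) g);
    last exact: cg.
  apply: cvgD; last exact: cvg_snd.
  by apply: cvgZr_tmp; exact: cvg_fst.
(* For [|t| < 1] all translates of [f] along [v] are supported in the radius [K + |v|]. *)
have := @is_derive_integralRn (fun t x => f (t *: v + x))
  (fun t x => 'D_v f (t *: v + x)) 0 1 (K + `|v|) ltr01.
case.
- move=> t _ x; apply: (@continuous_comp _ _ _ (fun x => t *: v + x) f);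
    last exact: cf.
  by apply: (@cvgD _ _ _ (nbhs x) _ (fun=> t *: v) id (t *: v) x);
    [exact: cvg_cst|exact: cvg_id].
- move=> t; rewrite subr0 => t1 x Kx; apply: fK.
  apply/lt_norm_shift/(le_lt_trans _ Kx).
  by rewrite lerD2l normrZ ler_piMl// ltW.
- by move=> t x _; exact: is_derive_line.
- by move=> t x _; exact: (cline _ cdf).
move=> _; rewrite (_ : (fun t => _) = cst (integralRn f)); last first.
  by apply/funext => t; rewrite (integralRn_shift _ cf fK).
rewrite derive_cst => /esym; congr (_ = 0); congr integralRn.
by apply/funext => x; rewrite scale0r add0r.
Qed.

(** If [f x0 > 0], continuity keeps [f] above [f x0 / 2] on a box around [x0], which has positive
    measure. Translating by [x0] centres this box at the origin, where [lebesgue_tuple_box] measures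
    it. *)
Lemma integralRn_ge0_eq0 f K : continuous f -> supported_in K f ->
  (forall x, 0 <= f x) -> integralRn f = 0 -> forall x, f x = 0.
Proof.
move=> cf fK f0 If x0; apply/eqP; rewrite eq_le f0 andbT leNgt; apply/negP => fx0.
pose c := f x0 / 2; have c0 : 0 < c by rewrite divr_gt0.
have [d d0 Hd] : exists2 d, 0 < d & forall x, `|x| <= d -> c <= f (x0 + x).
  have /cvgrPdist_le/(_ _ c0)/nbhs_ballP[d /= d0 Hd] := cf x0.
  exists (d / 2) => [|x xd]; first by rewrite divr_gt0.
  have := Hd (x0 + x); rewrite -ball_normE/= opprD addNKr normrN.
  rewrite (le_lt_trans xd) ?ltr_pdivrMr ?mulr2n ?mulrDr ?mulr1 ?ltrDl//.
  move=> /(_ isT); rewrite ler_distl => /andP[_].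
  by rewrite -lerBlDr {1}[f x0]splitr addrK.
have cfs : continuous (fun x => f (x0 + x)).
  move=> x; apply: (@continuous_comp _ _ _ (fun x => x0 + x) f); last exact: cf.
  by apply: (@cvgD _ _ _ (nbhs x) _ (fun=> x0) id x0 x);
    [exact: cvg_cst|exact: cvg_id].
have fsK : supported_in (K + `|x0|) (fun x => f (x0 + x)).
  by move=> x Kx; exact/fK/lt_norm_shift.
have := integralRn_shift x0 cf fK; rewrite If => /eqP; apply/negP.
rewrite gt_eqF// integralRnE.
apply: (@lt_le_trans _ _ (Rintegral mu setT
    (fun t => c * \1_(row_box n d) t))); last first.
  apply: le_Rintegral => //.
  - by apply: integrable_box; exact: ltW.
  - exact: (integrable_continuous_supported cfs fsK).
  - move=> t _; rewrite indicE; have [/set_mem td|_] := boolP (t \in _).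
      by rewrite mulr1; apply: Hd; apply/rV_norm_le => [|i]; [exact: ltW|rewrite mxE].
    by rewrite mulr0.
have := @integrable_box R n 1 d (ltW d0).
under eq_fun do rewrite mul1r.
move=> i1; rewrite RintegralZl// mulr_gt0// /Rintegral.
rewrite integral_indic//; last exact: measurable_row_box.
rewrite setIT [X in fine X]lebesgue_tuple_box ?ltW//=.
by rewrite exprn_gt0// mulr_gt0.
Qed.

End DiffUnder.

(** * Smooth bump functions *)

Section Bump.
Context {R : realType}.

(** The flat function [exp(-1/x)] at [k = 0]; the factors [x^-k] make the family closed under
    differentiation up to linear combinations. *)
Definition bump_exp (k : nat) (x : R) : R :=
  if 0 < x then x^-1 ^+ k * expR (- x^-1) else 0.

Lemma bump_exp_ge0 k x : 0 <= bump_exp k x.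
Proof.
rewrite /bump_exp; case: ifP => // x0.
by rewrite mulr_ge0 ?expR_ge0// exprn_ge0// invr_ge0 ltW.
Qed.

Lemma bump_exp_le k x : bump_exp k x <= (k.+1)`!%:R * `|x|.
Proof.
rewrite /bump_exp; case: ifP => [x0|_]; last by rewrite mulr_ge0.
have y0 : 0 < x^-1 by rewrite invr_gt0.
have f0 : 0 < (k.+1)`!%:R :> R by rewrite ltr0n fact_gt0.
rewrite expRN ler_pdivrMr ?expR_gt0// gtr0_norm// -(ler_pM2l y0) -exprS.
have := expR_ge1Dxn k (ltW y0).
rewrite [X in _ -> _ <= X](_ : _ = (k.+1)`!%:R * expR x^-1); last first.
  by rewrite [_ * x]mulrC !mulrA mulVf ?mul1r// gt_eqF.
rewrite [_`!%:R * _]mulrC -ler_pdivrMr// => /(le_trans _); apply.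
by rewrite lerDr.
Qed.

(** Away from 0 this is the product rule. At 0 the difference quotient of [bump_exp k] is exactly
    [bump_exp k.+1], which tends to 0 by the linear bound [bump_exp_le]. *)
Lemma is_derive_bump_exp k x : is_derive x (1 : R) (bump_exp k)
  (- k%:R * bump_exp k.+1 x + bump_exp k.+2 x).
Proof.
have [x0|x0|->] := ltgtP x 0.
- rewrite /bump_exp ltNge ltW//= mulr0 addr0.
  apply: (@near_eq_is_derive _ _ _ (cst 0)).
  near=> y; rewrite /cst ltNge ltW//=.
  by near: y; exact: lt_nbhsl.
- rewrite {2 3}/bump_exp x0.
  apply: (@near_eq_is_derive _ _ _
      ((fun y : R => y^-1 ^+ k) * (fun y : R => expR (- y^-1)))).
    near=> y; rewrite /bump_exp ifT//.
    by near: y; exact: lt_nbhsr.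
  have dV : is_derive x (1 : R) (fun y : R => y^-1) (- x ^- 2).
    split; first by apply: derivableV; [rewrite gt_eqF|exact: derivable_id].
    by rewrite deriveV ?gt_eqF// derive_id [_ *: _]mulr1.
  have dVk : is_derive x (1 : R) (fun y : R => y^-1 ^+ k)
      ((k%:R * x^-1 ^+ k.-1) *: (- x ^- 2)).
    rewrite (_ : (fun y : R => _) = (fun y : R => y^-1) ^+ k); last first.
      by apply/funext => y; rewrite exprfctE.
    exact: is_deriveX.
  have dE : is_derive x (1 : R) (fun y : R => expR (- y^-1))
      (expR (- x^-1) * (x ^- 2)).
    apply: (@is_derive1_comp _ expR (fun y : R => - y^-1)).
    by rewrite -[X in is_derive _ _ _ X]opprK; exact: is_deriveN.
  apply: is_derive_eq; rewrite /GRing.scale/=.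
  case: k {dVk} => [|k]; rewrite /= -?exprVn; first by rewrite !expr0; ring.
  by rewrite !exprS; ring.
- rewrite {2 3}/bump_exp ltxx mulr0 addr0.
  have E (h : R) : h != 0 ->
      h^-1 *: ((bump_exp k \o shift 0) (h *: 1) - bump_exp k 0) =
      bump_exp k.+1 h.
    move=> h0; rewrite /= addr0 [h *: 1]mulr1 {2}/bump_exp ltxx subr0.
    rewrite /bump_exp; case: ifP => _; last by rewrite scaler0.
    by rewrite exprS -mulrA.
  have cv : h^-1 *: ((bump_exp k \o shift 0) (h *: (1:R)) - bump_exp k 0)
      @[h --> (0 : R)^'] --> (0 : R).
    apply/cvgrPdist_le => e e0; near=> h.
    rewrite sub0r normrN E; last by near: h; exact: nbhs_dnbhs_neq.
    rewrite ger0_norm ?bump_exp_ge0// (le_trans (bump_exp_le _ _))//.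
    have f0 : 0 < (k.+2)`!%:R :> R by rewrite ltr0n fact_gt0.
    rewrite mulrC -ler_pdivlMr// ltW//.
    by near: h; apply: dnbhs0_lt; rewrite divr_gt0// ltr0n fact_gt0.
  split; first by apply/cvg_ex; exists 0.
  exact: cvg_lim.
Unshelve. all: by end_near. Qed.

Lemma derivable_comp_rV n (f : R -> R) (q : 'rV[R]_n -> R) x v :
  derivable f (q x) 1 -> differentiable q x ->
  differentiable (f \o q) x /\ 'D_v (f \o q) x = 'D_1 f (q x) * 'D_v q x.
Proof.
move=> df dq; have df' := (derivable1_diffP f (q x)).1 df.
split; first exact: differentiable_comp.
rewrite deriveE; last exact: differentiable_comp.
rewrite diff_comp//= (deriv1E df) -derive1E -deriveE//.
by rewrite mulrC.
Qed.

(* The derivatives of [bump_exp 0 \o q] remain in the algebra generated by the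
   coordinates and the functions [bump_exp k \o q]. *)
Inductive bump_alg n (q : 'rV[R]_n -> R) : ('rV[R]_n -> R) -> Prop :=
| bump_cst c : bump_alg q (fun=> c)
| bump_coord i : bump_alg q (fun x => x 0 i)
| bump_comp k : bump_alg q (bump_exp k \o q)
| bump_add f g : bump_alg q f -> bump_alg q g -> bump_alg q (f + g)
| bump_mul f g : bump_alg q f -> bump_alg q g -> bump_alg q (f * g).

Lemma bump_algE n (q : 'rV[R]_n -> R) f g :
  bump_alg q f -> f =1 g -> bump_alg q g.
Proof. by move=> + /funext <-. Qed.

Lemma derive_coord n (i : 'I_n) (x v : 'rV[R]_n) :
  differentiable (fun y : 'rV[R]_n => y 0 i) x /\
  'D_v (fun y : 'rV[R]_n => y 0 i) x = v 0 i.
Proof.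
have h := @differentiable_coord R 1 n x 0 i; split => //.
have := @derive_mx R _ 1 n id x v (@derivable_id _ _ x v).
by rewrite derive_id => /rowP/(_ i); rewrite mxE => ->.
Qed.

(** Induction on the generation of [f]. Composition with [q] produces a factor ['D_v q] by the chain
    rule, which is why the derivatives of [q] must lie in the algebra. *)
Lemma bump_alg_derive n (q : 'rV[R]_n -> R) f :
  (forall x, differentiable q x) -> (forall v, bump_alg q ('D_v q)) ->
  bump_alg q f ->
  (forall x, differentiable f x) /\ (forall v, bump_alg q ('D_v f)).
Proof.
move=> dq aq; elim=> {f} [c|i|k|f g af [df af'] ag [dg ag']|f g af [df af'] ag [dg ag']].
- split=> [x|v]; first exact: differentiable_cst.
  by apply: (bump_algE (bump_cst q 0)) => x; rewrite derive_cst.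
- split=> [x|v]; first exact: (derive_coord i x 0).1.
  by apply: (bump_algE (bump_cst q (v 0 i))) => x; rewrite (derive_coord i x v).2.
- have H x v := @derivable_comp_rV n (bump_exp k) q x v
    (@ex_derive _ _ _ _ _ _ _ (is_derive_bump_exp k (q x))) (dq x).
  split=> [x|v]; first exact: (H x 0).1.
  apply: (bump_algE (f := ((fun=> - k%:R) * (bump_exp k.+1 \o q)
     + (bump_exp k.+2 \o q)) * 'D_v q)).
    apply: bump_mul => //; apply: bump_add; last exact: bump_comp.
    by apply: bump_mul; [exact: bump_cst|exact: bump_comp].
  move=> x; rewrite (H x v).2.
  by rewrite (@derive_val _ _ _ _ _ _ _ (is_derive_bump_exp k (q x))).
- split=> [x|v]; first exact: differentiableD.
  apply: (bump_algE (bump_add (af' v) (ag' v))) => x.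
  by rewrite deriveD//; exact: diff_derivable.
- split=> [x|v]; first exact: differentiableM.
  apply: (bump_algE (bump_add (bump_mul af (ag' v)) (bump_mul ag (af' v)))) => x.
  by rewrite deriveM//; exact: diff_derivable.
Qed.

Lemma bump_alg_sum n (q : 'rV[R]_n -> R) m (f : 'I_m -> 'rV[R]_n -> R) :
  (forall i, bump_alg q (f i)) -> bump_alg q (\sum_(i < m) f i).
Proof.
move=> af; apply: (big_ind (bump_alg q)) => //; first exact: (bump_cst q 0).
by move=> *; exact: bump_add.
Qed.

Lemma bump_alg_smooth n (q : 'rV[R]_n -> R) (f : 'rV[R]_n -> R) :
  (forall x, differentiable q x) -> (forall v, bump_alg q ('D_v q)) ->
  bump_alg q f -> smooth f.
Proof.
move=> dq aq af s x _.
suff /(bump_alg_derive dq aq)[+ _] : bump_alg q (foldr (fun v g => 'D_v g) f s).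
  exact.
by elim: s => //= v s IH; have [_] := bump_alg_derive dq aq IH; exact.
Qed.

(** The Euclidean distance is used, not the sup norm: its square is a polynomial, so the derivatives
    of the inner function are affine in the coordinates and stay in [bump_alg]. *)
Definition bump n (a : 'rV[R]_n) (d : R) : 'rV[R]_n -> R :=
  bump_exp 0 \o (fun x => d ^+ 2 - \sum_i (x 0 i - a 0 i) ^+ 2).

Lemma bump_smooth n (a : 'rV[R]_n) d : smooth (bump a d).
Proof.
set q := fun x : 'rV[R]_n => d ^+ 2 - \sum_i (x 0 i - a 0 i) ^+ 2.
pose p i : 'rV[R]_n -> R := (fun x => x 0 i) - (fun=> a 0 i).
have dp i x : differentiable (p i) x.
  by apply: differentiableB; [exact: (derive_coord i x 0).1|exact: differentiable_cst].
have Dp i x v : 'D_v (p i) x = v 0 i.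
  rewrite deriveB ?derive_cst ?subr0 ?(derive_coord i x v).2//.
  exact/diff_derivable/(derive_coord i x v).1.
have qE : q = (fun=> d ^+ 2) - \sum_i (p i * p i).
  apply/funext => x; rewrite /q; congr (_ - _).
  by rewrite fct_sumE; apply: eq_bigr => i _; rewrite expr2.
have dpp i x : differentiable (p i * p i) x by exact: differentiableM.
have dq x : differentiable q x.
  rewrite qE; apply: differentiableB; first exact: differentiable_cst.
  exact: differentiable_sum.
apply: (@bump_alg_smooth _ q) => //; last exact: bump_comp.
move=> v.
apply: (bump_algE (f := (fun=> - 2) * \sum_i (p i * (fun=> v 0 i)))).
  apply: bump_mul; first exact: bump_cst.
  apply: bump_alg_sum => i; apply: bump_mul; last exact: bump_cst.
  apply: (bump_algE (bump_add (bump_coord q i) (bump_cst q (- a 0 i)))) => x.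
  by [].
move=> x; rewrite qE deriveB ?derive_cst ?sub0r.
- rewrite derive_sum; last by move=> i; exact/diff_derivable.
  rewrite -[LHS]/(- 2 * (\sum_i (p i * (fun=> v 0 i))) x).
  rewrite fct_sumE mulNr mulr_sumr; congr (- _); apply: eq_bigr => i _.
  rewrite deriveM ?Dp; [|exact/diff_derivable..].
  by rewrite /GRing.scale/= -[LHS]/(2 * (p i x * v 0 i)); ring.
- exact: derivable_cst.
- exact/diff_derivable/differentiable_sum.
Qed.

Lemma bump_ge0 n (a : 'rV[R]_n) d x : 0 <= bump a d x.
Proof. exact: bump_exp_ge0. Qed.

Lemma bump_gt0 n (a : 'rV[R]_n) d : 0 < d -> 0 < bump a d a.
Proof.
move=> d0; rewrite /bump/= big1 => [|i _]; last by rewrite subrr expr0n.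
by rewrite subr0 /bump_exp exprn_gt0// expr0 mul1r expR_gt0.
Qed.

(** Each squared coordinate of [x - a] is at most their sum, so the Euclidean ball lies in the
    sup-norm ball of the same radius. *)
Lemma bump_eq0 n (a : 'rV[R]_n) d x : 0 < d -> d < `|x - a| -> bump a d x = 0.
Proof.
move=> d0; rewrite ltNge => /negP dx; rewrite /bump/= /bump_exp; case: ifP => //.
rewrite subr_gt0 => h; exfalso; apply: dx; apply/rV_norm_le => [|i]; first exact: ltW.
rewrite -(@ler_pXn2r _ 2) ?nnegrE//; last exact: ltW.
rewrite real_normK ?num_real// !mxE.
apply: le_trans (ltW h); rewrite (bigD1 i)//= lerDl sumr_ge0// => j _.
exact: sqr_ge0.
Qed.

End Bump.

(** * Calculus of variations *)

Section C1Functions.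
Context {R : realType} {n : nat}.
Implicit Types f g h : 'rV[R]_n -> R.

(** The regularity consumed by integration by parts. Smooth functions and the coordinates of the
    time slices of [M] and [rho] all belong to this class, which is stable under products. *)
Definition C1 f := (forall x, differentiable f x) /\
  (forall v, continuous ('D_v f)).

Lemma C1_continuous f : C1 f -> continuous f.
Proof. by move=> [df _] x; exact: differentiable_continuous. Qed.

Lemma C1_derivable f x v : C1 f -> derivable f x v.
Proof. by move=> [df _]; exact: diff_derivable. Qed.

Lemma C1_partial f v : C1 f -> continuous ('D_v f).
Proof. by move=> []. Qed.

Lemma rV_continuousD f g : continuous f -> continuous g ->
  continuous (fun x => f x + g x).
Proof. by move=> cf cg x; exact: (cvgD (cf x) (cg x)). Qed.

Lemma rV_continuousM f g : continuous f -> continuous g ->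
  continuous (fun x => f x * g x).
Proof. by move=> cf cg x; exact: (cvgM (cf x) (cg x)). Qed.

Lemma rV_continuous_sum m (f : 'I_m -> 'rV[R]_n -> R) :
  (forall i, continuous (f i)) -> continuous (fun x => \sum_(i < m) f i x).
Proof.
move=> cf; rewrite (_ : (fun x => _) = \sum_(i < m) f i); last first.
  by apply/funext => x; rewrite fct_sumE.
by apply: (big_ind (fun g : 'rV[R]_n -> R => continuous g)) => //;
  [exact: cst_continuous|exact: rV_continuousD].
Qed.

Lemma C1M f g : C1 f -> C1 g -> C1 (fun x => f x * g x).
Proof.
move=> Cf Cg; have [df cdf] := Cf; have [dg cdg] := Cg; split=> [x|v].
  exact: (differentiableM (df x) (dg x)).
rewrite (_ : 'D_v _ = fun x => f x * 'D_v g x + g x * 'D_v f x).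
  by apply: rV_continuousD; apply: rV_continuousM => //; exact: C1_continuous.
by apply/funext => x; apply: deriveM; exact: C1_derivable.
Qed.

Lemma derive_mul f g x v : C1 f -> C1 g ->
  'D_v (fun y => f y * g y) x = f x * 'D_v g x + g x * 'D_v f x.
Proof. by move=> Cf Cg; apply: deriveM; exact: C1_derivable. Qed.

Lemma smooth_C1 f : smooth f -> C1 f.
Proof.
move=> sf; split=> [x|v x]; first exact: (sf [::]).
exact/differentiable_continuous/(sf [:: v]).
Qed.

Lemma smooth_cst (V W : normedModType R) (w : W) : smooth (fun _ : V => w).
Proof.
move=> s x _; suff [c ->] : exists c : W,
    foldr (fun v (g : V -> W) => 'D_v g) (fun=> w) s = cst c.
  exact: differentiable_cst.
elim: s => [|v s [c IH]]; first by exists w.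
by exists 0; apply/funext => y; rewrite /= IH derive_cst.
Qed.

(** Every iterated derivative keeps the fixed factor [w]. This produces test fields that point along
    one coordinate. *)
Lemma smooth_scale f (w : 'rV[R]_n) : smooth f -> smooth (fun x => f x *: w).
Proof.
move=> sf s x _.
rewrite (_ : foldr _ _ _ = fun x => foldr (fun v g => 'D_v g) f s x *: w).
  by apply: differentiableZl; exact: sf.
elim: s => //= v s ->; apply/funext => y.
rewrite deriveE; last by apply: differentiableZl; exact: sf.
rewrite diffZl; last exact: sf.
by rewrite deriveE//; exact: sf.
Qed.

Lemma coord_derive (u : 'rV[R]_n -> 'rV[R]_n) i v x : differentiable u x ->
  'D_v (fun y => u y 0 i) x = 'D_v u x 0 i.
Proof.
by move=> /(@diff_derivable _ _ _ _ _ v)/derive_mx/rowP/(_ i); rewrite mxE => ->.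
Qed.

Lemma coord_C1 (u : 'rV[R]_n -> 'rV[R]_n) i :
  (forall x, differentiable u x) -> (forall v, continuous ('D_v u)) ->
  C1 (fun x => u x 0 i).
Proof.
move=> du cdu; split=> [x|v].
  apply: (@differentiable_comp _ _ _ _ u (fun y : 'rV[R]_n => y 0 i)) => //.
  exact: differentiable_coord.
rewrite (_ : 'D_v _ = fun x => 'D_v u x 0 i).
  move=> x; apply: (cvg_comp ('D_v u) (fun y : 'rV[R]_n => y 0 i)).
    exact: cdu.
  exact: coord_continuous.
by apply/funext => x; exact: coord_derive.
Qed.

Lemma smooth_coord_C1 (u : 'rV[R]_n -> 'rV[R]_n) i :
  smooth u -> C1 (fun x => u x 0 i).
Proof.
move=> su; apply: coord_C1 => [x|v x]; first exact: (su [::]).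
exact/differentiable_continuous/(su [:: v]).
Qed.

Lemma supported_derive K f v : supported_in K f -> supported_in K ('D_v f).
Proof.
move=> fK x Kx; rewrite (near_eq_derive (g := cst 0)) ?derive_cst//.
near=> y; rewrite fK//; near: y.
have : \forall y \near x, K < `|y|.
  by have /cvgr_gt := @norm_continuous R 'rV[R]_n x; exact.
exact.
Unshelve. all: by end_near. Qed.

Lemma supported_in_le (W : zmodType) K L (f : 'rV[R]_n -> W) :
  K <= L -> supported_in K f -> supported_in L f.
Proof. by move=> KL fK x Lx; apply: fK; exact: le_lt_trans Lx. Qed.

(** Bounded closed sets are compact here, so compact support amounts to a support radius, the form
    used by the integral estimates. *)
Lemma test_funP (W : normedModType R) (f : 'rV[R]_n -> W) :
  test_fun f <-> smooth f /\ exists K, supported_in K f.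
Proof.
split=> [[sf cf]|[sf [K fK]]]; split => //.
  have [K [_ HK]] := compact_bounded cf; exists (K + 1) => x Kx.
  apply/eqP; apply: contraTT Kx => fx; rewrite -leNgt.
  by apply: (HK (K + 1)); [rewrite ltrDl|exact: subset_closure].
apply: (subclosed_compact _ (@compact_ball0 R n K)); first exact: closed_closure.
have cK : closed [set x : 'rV[R]_n | `|x| <= K].
  apply: compact_closed; [exact: norm_hausdorff|exact: compact_ball0].
rewrite closureE; apply: smallest_sub => // x /=.
by apply: contraNT; rewrite -ltNge => /fK ->.
Qed.

(** Continuous functions with compact support: on this class the integral is linear with no common
    radius to supply. *)
Definition Cc f := continuous f /\ exists K, supported_in K f.

Lemma CcD f g : Cc f -> Cc g -> Cc (fun x => f x + g x).
Proof.
move=> [cf [K fK]] [cg [L gL]]; split; first exact: rV_continuousD.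
exists (Num.max K L) => x; rewrite gt_max => /andP[/fK -> /gL ->].
by rewrite addr0.
Qed.

Lemma CcMl f g : continuous f -> Cc g -> Cc (fun x => f x * g x).
Proof.
move=> cf [cg [L gL]]; split; first exact: rV_continuousM.
by exists L => x /gL ->; rewrite mulr0.
Qed.

Lemma CcMr f g : Cc f -> continuous g -> Cc (fun x => f x * g x).
Proof.
move=> cf cg; rewrite (_ : (fun x => _) = fun x => g x * f x); first exact: CcMl.
by apply/funext => x; rewrite mulrC.
Qed.

Lemma Cc0 : Cc (fun=> 0).
Proof. by split; [exact: cst_continuous|exists 0]. Qed.

Lemma Cc_sum m (f : 'I_m -> 'rV[R]_n -> R) : (forall i, Cc (f i)) ->
  Cc (fun x => \sum_(i < m) f i x).
Proof.
move=> cf; rewrite (_ : (fun x => _) = \sum_(i < m) f i); last first.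
  by apply/funext => x; rewrite fct_sumE.
by apply: (big_ind Cc) => //; [exact: Cc0|exact: CcD].
Qed.

Lemma Cc_integralD f g : Cc f -> Cc g ->
  integralRn (fun x => f x + g x) = integralRn f + integralRn g.
Proof.
move=> [cf [K fK]] [cg [L gL]]; apply: (@integralRnD _ _ (Num.max K L)) => //.
  by apply: supported_in_le fK; rewrite le_max lexx.
by apply: supported_in_le gL; rewrite le_max lexx orbT.
Qed.

Lemma Cc_integralZ a f : Cc f ->
  integralRn (fun x => a * f x) = a * integralRn f.
Proof. by move=> [cf [K fK]]; exact: integralRnZ fK. Qed.

Lemma Cc_integralB f g : Cc f -> Cc g ->
  integralRn (fun x => f x - g x) = integralRn f - integralRn g.
Proof.
move=> Cf Cg; rewrite -[in RHS]mulN1r -Cc_integralZ// -Cc_integralD//.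
  by congr integralRn; apply/funext => x; rewrite mulN1r.
by apply: CcMl => //; exact: cst_continuous.
Qed.

Lemma CcB f g : Cc f -> Cc g -> Cc (fun x => f x - g x).
Proof.
move=> Cf Cg; rewrite (_ : (fun x => _) = fun x => f x + - 1 * g x).
  by apply: CcD => //; apply: CcMl => //; exact: cst_continuous.
by apply/funext => x; rewrite mulN1r.
Qed.

Lemma Cc_integral_sum m (f : 'I_m -> 'rV[R]_n -> R) : (forall i, Cc (f i)) ->
  integralRn (fun x => \sum_(i < m) f i x) = \sum_(i < m) integralRn (f i).
Proof.
elim: m f => [|m IH] f cf.
  (* The zero function integrates to 0 by homogeneity with factor 0. *)
  rewrite big_ord0; transitivity (0 * integralRn (fun _ : 'rV[R]_n => 0 : R));
    last by rewrite mul0r.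
  rewrite -Cc_integralZ.
    by congr integralRn; apply/funext => x; rewrite big_ord0 mul0r.
  exact: Cc0.
rewrite big_ord_recl -IH// -Cc_integralD//; last exact: Cc_sum.
by congr integralRn; apply/funext => x; rewrite big_ord_recl.
Qed.

Lemma Cc_integral_derive f v : C1 f -> (exists K, supported_in K f) ->
  Cc ('D_v f) /\ integralRn ('D_v f) = 0.
Proof.
move=> Cf [K fK]; split.
  by split; [exact: C1_partial|exists K; exact: supported_derive].
apply: (integralRn_derive (C1_continuous Cf) fK _ (C1_partial Cf)) => x.
exact: C1_derivable.
Qed.

Lemma test_fun_Cc f : test_fun f -> Cc f.
Proof.
move=> /test_funP[/smooth_C1/C1_continuous cf [K fK]]; split => //.
by exists K.
Qed.

Lemma test_fun_coord (phi : 'rV[R]_n -> 'rV[R]_n) i :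
  test_fun phi -> Cc (fun x => phi x 0 i) /\ C1 (fun x => phi x 0 i).
Proof.
move=> /test_funP[sphi [K phiK]]; have C := smooth_coord_C1 i sphi.
split => //; split; first exact: C1_continuous.
by exists K => x /phiK ->; rewrite mxE.
Qed.

(** If [g a > 0], a bump supported where [g] is positive makes the integrand nonnegative with zero
    integral, hence zero at [a], where both factors are positive. Applying this to [h] and to [- h]
    gives both inequalities. *)
Lemma du_bois_reymond h : continuous h ->
  (forall chi : 'rV[R]_n -> R, test_fun chi ->
     integralRn (fun x => chi x * h x) = 0) ->
  forall a, h a = 0.
Proof.
move=> + + a; have pos g : continuous g ->
    (forall chi : 'rV[R]_n -> R, test_fun chi ->
       integralRn (fun x => chi x * g x) = 0) -> g a <= 0.
  move=> cg Ig; rewrite leNgt; apply/negP => ga.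
  have /cvgr_gt/(_ _ ga)/nbhs_ballP[d /= d0 Hd] := cg a.
  have d20 : 0 < d / 2 by rewrite divr_gt0.
  have gpos x : `|x - a| <= d / 2 -> 0 < g x.
    move=> xd; apply: Hd; rewrite -ball_normE/= distrC (le_lt_trans xd)//.
    by rewrite ltr_pdivrMr// mulr2n mulrDr mulr1 ltrDl.
  pose chi := bump a (d / 2).
  have chi_test : test_fun chi.
    apply/test_funP; split; first exact: bump_smooth.
    exists (d / 2 + `|a|) => x xd; apply: bump_eq0 => //.
    by rewrite addrC; apply: lt_norm_shift; rewrite normrN.
  have [cchi [K chiK]] := CcMr (test_fun_Cc chi_test) cg.
  have chig x : 0 <= chi x * g x.
    have [xd|xd] := leP `|x - a| (d / 2).
      by rewrite mulr_ge0 ?bump_ge0// ltW// gpos.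
    by rewrite /chi bump_eq0// mul0r.
  have /eqP := integralRn_ge0_eq0 cchi chiK chig (Ig _ chi_test) a.
  by apply/negP; rewrite mulf_neq0// gt_eqF// bump_gt0.
move=> ch Ih; apply/eqP; rewrite eq_le pos//= -oppr_le0.
apply: (pos (fun x => - h x)); first by move=> x; exact: (cvgN (ch x)).
move=> chi tchi; transitivity (- 1 * integralRn (fun x => chi x * h x)).
  rewrite -Cc_integralZ; last exact: (CcMr (test_fun_Cc tchi)).
  by congr integralRn; apply/funext => x; rewrite mulrN mulN1r.
by rewrite Ih// mulr0.
Qed.

Lemma test_fun0 (W : normedModType R) : test_fun (fun _ : 'rV[R]_n => 0 : W).
Proof. by apply/test_funP; split; [exact: smooth_cst|exists 0]. Qed.

Lemma Cc_dot (phi u : 'rV[R]_n -> 'rV[R]_n) : test_fun phi ->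
  (forall i, continuous (fun x => u x 0 i)) -> Cc (fun x => dot (phi x) (u x)).
Proof.
move=> tphi cu; apply: Cc_sum => i; apply: CcMr (cu i).
exact: (test_fun_coord i tphi).1.
Qed.

Lemma du_bois_reymond_rV (u : 'rV[R]_n -> 'rV[R]_n) :
  (forall i, continuous (fun x => u x 0 i)) ->
  (forall phi, test_fun phi -> integralRn (fun x => dot (phi x) (u x)) = 0) ->
  forall x, u x = 0.
Proof.
move=> cu Iu x; apply/rowP => i; rewrite mxE.
apply: (du_bois_reymond (cu i)) => chi /test_funP[schi [K chiK]].
have : test_fun (fun x => chi x *: (delta_mx 0 i : 'rV[R]_n)).
  apply/test_funP; split; first exact: smooth_scale.
  by exists K => y /chiK ->; rewrite scale0r.
move=> /Iu <-; congr integralRn; apply/funext => y.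
rewrite /dot (bigD1 i)//= big1 => [|j ji]; rewrite !mxE eqxx/=.
  by rewrite eqxx mulr1 addr0.
by rewrite (negbTE ji) mulr0 mul0r.
Qed.

End C1Functions.

(** * Fields depending smoothly on time and space jointly *)

Section JointSmoothness.
Context {R : realType} {n : nat} {W : normedModType R}.
Variables (J : set R) (G : R -> 'rV[R]_n -> W).
Hypothesis sG : smooth_on (J `*` setT)
  (fun p : (R^o * 'rV[R]_n)%type => G p.1 p.2).
Let G2 := fun p : (R^o * 'rV[R]_n)%type => G p.1 p.2.

(** Taken as a directional derivative on the product space, so that its joint continuity is an
    instance of [smooth_on]. *)
Definition time_derive (t : R) (x : 'rV[R]_n) : W :=
  'D_((1 : R^o, 0 : 'rV[R]_n) : (R^o * 'rV[R]_n)%type) G2 (t, x).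

Lemma is_derive_time t x : J t -> is_derive t (1 : R) (G ^~ x) (time_derive t x).
Proof.
move=> Jt; have dG : differentiable G2 (t, x) by apply: (sG [::]); split.
have E : (fun h : R => h^-1 *: (((G ^~ x) \o shift t) (h *: 1) - G t x)) =
  (fun h : R => h^-1 *: ((G2 \o shift ((t, x) : (R^o * 'rV[R]_n)%type))
    (h *: ((1 : R^o, 0 : 'rV[R]_n) : (R^o * 'rV[R]_n)%type)) - G2 (t, x))).
  by apply/funext => h; rewrite /G2 /= scaler0 add0r.
have := @diff_derivable _ _ _ _ _
  ((1 : R^o, 0 : 'rV[R]_n) : (R^o * 'rV[R]_n)%type) dG.
by rewrite /time_derive => dv; split; rewrite /derivable /derive E.
Qed.

Lemma continuous_time_derive t x : J t ->
  {for (t, x), continuous (fun p : (R^o * 'rV[R]_n)%type => time_derive p.1 p.2)}.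
Proof.
move=> Jt; rewrite (_ : (fun p => _) =
   'D_((1 : R^o, 0 : 'rV[R]_n) : (R^o * 'rV[R]_n)%type) G2); last first.
  by apply/funext => -[].
apply: differentiable_continuous.
by apply: (sG [:: ((1 : R^o, 0 : 'rV[R]_n) : (R^o * 'rV[R]_n)%type)]).
Qed.

Lemma differentiable_slice (f : (R^o * 'rV[R]_n)%type -> W) t x :
  differentiable f (t, x) -> differentiable (fun y => f (t, y)) x.
Proof.
move=> df; apply: (@differentiable_comp _ _ _ _
  (fun y : 'rV[R]_n => ((t : R^o), y)) f) => //.
Qed.

Lemma differentiable_space t x : J t -> differentiable (G t) x.
Proof. by move=> Jt; apply: (@differentiable_slice G2); apply: (sG [::]). Qed.

Lemma continuous_space_derive t v : J t -> continuous ('D_v (G t)).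
Proof.
move=> Jt x; pose w : (R^o * 'rV[R]_n)%type := (0, v).
(* A spatial derivative of a slice is the slice of the joint derivative in the direction
   [(0, v)]. *)
have -> : 'D_v (G t) = (fun y => 'D_w G2 (t, y)).
  apply/funext => y; rewrite /derive.
  rewrite (_ : (fun h : R => h^-1 *: ((G t \o shift y) (h *: v) - G t y)) =
    (fun h : R => h^-1 *: ((G2 \o shift ((t, y) : (R^o * 'rV[R]_n)%type)) (h *: w)
      - G2 (t, y))))//.
  by apply/funext => h; rewrite /G2 /= scaler0 add0r.
apply: differentiable_continuous.
by apply: (@differentiable_slice ('D_w G2)); apply: (sG [:: w]).
Qed.

Lemma continuous_time_derive_space t : J t -> continuous (time_derive t).
Proof.
move=> Jt x; apply: differentiable_continuous.
apply: (@differentiable_slice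
  ('D_((1 : R^o, 0 : 'rV[R]_n) : (R^o * 'rV[R]_n)%type) G2)).
by apply: (sG [:: ((1 : R^o, 0 : 'rV[R]_n) : (R^o * 'rV[R]_n)%type)]).
Qed.

End JointSmoothness.

(** * Variational derivatives: uniqueness, linear functionals, smoothness *)

Section LinearFunctionals.
Context {R : realType} {n : nat}.
Variables (phi : 'rV[R]_n -> 'rV[R]_n) (chi : 'rV[R]_n -> R).
Hypotheses (tphi : test_fun phi) (tchi : test_fun chi).
Implicit Types (M : 'rV[R]_n -> 'rV[R]_n) (rho : 'rV[R]_n -> R).

Lemma is_derive_scalel (c : R) :
  is_derive (0 : R) (1 : R) (fun e : R => e * c) c.
Proof.
have -> : (fun e : R => e * c) = c \*: (id : R -> R).
  by apply/funext => e; rewrite /= mulrC.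
by apply: is_derive_eq; rewrite [c *: _]mulr1.
Qed.

Lemma smooth_coord_continuous (u : 'rV[R]_n -> 'rV[R]_n) i :
  smooth u -> continuous (fun x => u x 0 i).
Proof. by move=> su; apply: C1_continuous; exact: smooth_coord_C1. Qed.

(** The difference of integrands is exactly [e * dot psi phi], so the functional of [e] is linear
    even where the integral of the functional itself diverges. *)
Lemma is_derivM_linear M rho :
  is_derivM (linear_functional phi chi) M rho phi.
Proof.
have [sphi _] := tphi; split=> // psi tpsi.
rewrite (_ : (fun e => _) =
    fun e : R => e * integralRn (fun x => dot (psi x) (phi x))).
  exact: is_derive_scalel.
apply/funext => e; rewrite -Cc_integralZ; last first.
  by apply: Cc_dot => // i; exact: smooth_coord_continuous.
congr integralRn; apply/funext => x; rewrite /linear_functional opprD addrACA subrr addr0.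
rewrite /dot mulr_sumr -sumrB; apply: eq_bigr => i _; rewrite !mxE; ring.
Qed.

Lemma is_derivrho_linear M rho :
  is_derivrho (linear_functional phi chi) M rho chi.
Proof.
have [schi _] := tchi; split=> // psi tpsi.
rewrite (_ : (fun e => _) =
    fun e : R => e * integralRn (fun x => psi x * chi x)).
  exact: is_derive_scalel.
apply/funext => e; rewrite -Cc_integralZ; last first.
  by apply: CcMr; [exact: test_fun_Cc|exact/C1_continuous/smooth_C1].
by congr integralRn; apply/funext => x; rewrite /linear_functional; ring.
Qed.

(** Two candidates give the same derivative at 0, so their difference is orthogonal to every test
    field. Thus [get] returns any exhibited variational derivative. *)
Lemma is_derivM_unique (F : functional) M rho u w :
  is_derivM F M rho u -> is_derivM F M rho w -> u = w.
Proof.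
move=> [su Du] [sw Dw]; apply/funext => x; apply/eqP; rewrite -subr_eq0; apply/eqP.
move: x; apply: (du_bois_reymond_rV (u := fun x => u x - w x)).
  move=> i; rewrite (_ : (fun x => _) = fun x => u x 0 i + (- w x 0 i)).
    apply: rV_continuousD; first exact: smooth_coord_continuous.
    by move=> x; exact: (cvgN (@smooth_coord_continuous w i sw x)).
  by apply/funext => x; rewrite !mxE.
move=> psi tpsi; have [_ h1] := Du _ tpsi; have [_ h2] := Dw _ tpsi.
transitivity (integralRn (fun x => dot (psi x) (u x) - dot (psi x) (w x))).
  congr integralRn; apply/funext => x; rewrite /dot -sumrB.
  by apply: eq_bigr => i _; rewrite !mxE mulrBr.
rewrite Cc_integralB.
- by rewrite -h1 -h2 subrr.
- by apply: Cc_dot => // i; exact: smooth_coord_continuous.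
- by apply: Cc_dot => // i; exact: smooth_coord_continuous.
Qed.

Lemma is_derivrho_unique (F : functional) M rho a b :
  is_derivrho F M rho a -> is_derivrho F M rho b -> a = b.
Proof.
move=> [sa Da] [sb Db]; apply/funext => x; apply/eqP; rewrite -subr_eq0; apply/eqP.
have ca := C1_continuous (smooth_C1 sa); have cb := C1_continuous (smooth_C1 sb).
move: x; apply: (du_bois_reymond (h := fun x => a x - b x)).
  by apply: rV_continuousD => // x; exact: (cvgN (cb x)).
move=> psi tpsi; have [_ h1] := Da _ tpsi; have [_ h2] := Db _ tpsi.
transitivity (integralRn (fun x => psi x * a x - psi x * b x)).
  by congr integralRn; apply/funext => x; rewrite mulrBr.
by rewrite Cc_integralB ?h1; [rewrite -h1 -h2 subrr|apply: CcMr => //; exact: test_fun_Cc..].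
Qed.

Lemma derivM_linear M rho : Defs.derivM (linear_functional phi chi) M rho = phi.
Proof.
apply: get_unique; first exact: is_derivM_linear.
by move=> u /is_derivM_unique; apply; exact: is_derivM_linear.
Qed.

Lemma derivrho_linear M rho : derivrho (linear_functional phi chi) M rho = chi.
Proof.
apply: get_unique; first exact: is_derivrho_linear.
by move=> u /is_derivrho_unique; apply; exact: is_derivrho_linear.
Qed.

(* If no variational derivative exists, [get] returns a constant function. *)
Lemma derivM_smooth (H : functional) M rho : smooth (Defs.derivM H M rho).
Proof.
have [[u Hu]|nH] := pselect (exists u, is_derivM H M rho u).
  by have [] := getPex (ex_intro _ u Hu).
rewrite /Defs.derivM getPN; first exact: smooth_cst.
by move=> u Hu; apply: nH; exists u.
Qed.

Lemma derivrho_smooth (H : functional) M rho : smooth (derivrho H M rho).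
Proof.
have [[u Hu]|nH] := pselect (exists u, is_derivrho H M rho u).
  by have [] := getPex (ex_intro _ u Hu).
rewrite /derivrho getPN; first exact: smooth_cst.
by move=> u Hu; apply: nH; exists u.
Qed.

End LinearFunctionals.

(** * Weak form of the dynamics *)

Section WeakForm.
Context {R : realType} {n : nat}.
Variables (phi : 'rV[R]_n -> 'rV[R]_n) (chi : 'rV[R]_n -> R).
Hypotheses (tphi : test_fun phi) (tchi : test_fun chi).

(** The common form into which both the time derivative and the bracket are brought before they are
    compared. *)
Definition weak (A : 'rV[R]_n -> 'rV[R]_n) (B : 'rV[R]_n -> R) : R :=
  integralRn (fun x => dot (phi x) (A x) + chi x * B x).

Lemma cvg_dot (T : Type) (F : set_system T) (FF : Filter F)
    (f g : T -> 'rV[R]_n) (a b : 'rV[R]_n) :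
  f @ F --> a -> g @ F --> b -> (fun x => dot (f x) (g x)) @ F --> dot a b.
Proof.
move=> fa gb; rewrite (_ : (fun x => _) = \sum_i (fun x => f x 0 i * g x 0 i)).
  apply: (big_ind2 (fun (s : T -> R) (l : R) => s @ F --> l)).
  - exact: cvg_cst.
  - by move=> s1 l1 s2 l2 h1 h2; exact: cvgD.
  - move=> i _; apply: cvgM.
      exact: (cvg_comp f _ fa (@coord_continuous R 1 n 0 i a)).
    exact: (cvg_comp g _ gb (@coord_continuous R 1 n 0 i b)).
by apply/funext => x; rewrite fct_sumE.
Qed.

Lemma is_derive_dot (u : R -> 'rV[R]_n) (du w : 'rV[R]_n) t :
  is_derive t (1 : R) u du ->
  is_derive t (1 : R) (fun s => dot (u s) w) (dot du w).
Proof.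
move=> [Du du_eq].
have Di i : is_derive t (1 : R) (w 0 i \*: (fun s => u s 0 i)) (w 0 i *: du 0 i).
  apply: is_deriveZ; split; first by move/derivable_mxP: Du; exact.
  by move: (derive_mx Du); rewrite du_eq => /rowP/(_ i); rewrite mxE => ->.
rewrite (_ : (fun s => _) = \sum_(i < n) (w 0 i \*: (fun s => u s 0 i))).
  by apply: is_derive_eq; apply: eq_bigr => i _; rewrite mulrC.
by apply/funext => s; rewrite fct_sumE; apply: eq_bigr => i _; rewrite /= mulrC.
Qed.

(** The supports of [phi] and [chi] do not move with time, so one radius bounds the integrand for
    all times near [t]. *)
Lemma is_derive_evalF_linear (J : set R) (M : R -> 'rV[R]_n -> 'rV[R]_n)
    (rho : R -> 'rV[R]_n -> R) (t : R) : open J -> J t ->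
  smooth_on (J `*` setT) (fun p : (R^o * 'rV[R]_n)%type => M p.1 p.2) ->
  smooth_on (J `*` setT) (fun p : (R^o * 'rV[R]_n)%type => rho p.1 p.2 : R^o) ->
  is_derive t (1 : R)
    (fun s => evalF (linear_functional phi chi) (M s) (rho s))
    (weak (time_derive M t) (time_derive (rho : R -> 'rV[R]_n -> R^o) t)).
Proof.
move=> oJ Jt sM srho.
(* Openness of [J] leaves room on both sides of [t] to differentiate under the integral. *)
have [e e0 eJ] : exists2 e : R, 0 < e & forall s, `|s - t| < e -> J s.
  have /nbhs_ballP[e /= e0 eJ] : nbhs t J by exact: open_nbhs_nbhs.
  by exists e => // s st; apply: eJ; rewrite -ball_normE/= distrC.
have [sphi [K phiK]] := (test_funP phi).1 tphi.
have [schi [L chiL]] := (test_funP chi).1 tchi.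
have cphi i : continuous (fun x => phi x 0 i) by exact: smooth_coord_continuous.
have cchi : continuous chi by exact/C1_continuous/smooth_C1.
rewrite /weak.
rewrite (_ : (fun x => dot _ _ + _) = (fun x => dot (time_derive M t x) (phi x)
   + time_derive (rho : R -> 'rV[R]_n -> R^o) t x * chi x)); last first.
  apply/funext => x; rewrite [chi x * _]mulrC; congr (_ + _).
  by apply: eq_bigr => i _; rewrite mulrC.
apply: (@is_derive_integralRn _ _ (fun s => linear_functional phi chi (M s) (rho s))
  (fun s x => dot (time_derive M s x) (phi x)
    + time_derive (rho : R -> 'rV[R]_n -> R^o) s x * chi x)
  t e (Num.max K L) e0) => [s /eJ Js|s /eJ Js x|s x /eJ Js|s x /eJ Js].
- have cM i : continuous (fun x => M s x 0 i).
    apply/C1_continuous/coord_C1 => [x|v].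
      exact: (differentiable_space sM).
    exact: (continuous_space_derive sM).
  apply: rV_continuousD.
    by apply: rV_continuous_sum => i; exact: rV_continuousM.
  apply: rV_continuousM => // x.
  exact: (differentiable_continuous (differentiable_space srho x Js)).
- rewrite gt_max => /andP[Kx Lx]; rewrite /linear_functional phiK// chiL// mulr0.
  by rewrite addr0 /dot big1// => i _; rewrite mxE mulr0.
- apply: is_deriveD; first exact/is_derive_dot/(is_derive_time sM).
  rewrite (_ : (fun s => _) = chi x \*: (rho ^~ x)); last first.
    by apply/funext => r; rewrite /= mulrC.
  have h := is_derive_time srho x Js.
  by apply: is_derive_eq; rewrite mulrC.
- have cs (f : 'rV[R]_n -> R) : continuous f -> 
      {for (s, x), continuous (fun p : (R^o * 'rV[R]_n)%type => f p.2)}.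
    move=> cf; apply: (cvg_comp snd f); last exact: cf.
    exact: cvg_snd.
  apply: cvgD.
    apply: cvg_dot; first exact: (continuous_time_derive sM Js).
    apply: (cvg_comp snd phi); first exact: cvg_snd.
    exact: (differentiable_continuous (sphi [::] x I)).
  apply: cvgM; first exact: (continuous_time_derive srho Js).
  exact: cs.
Qed.

Lemma ad_star_continuous (M u : 'rV[R]_n -> 'rV[R]_n) i :
  (forall j, C1 (fun x => M x 0 j)) -> smooth u ->
  continuous (fun x => ad_star u M x 0 i).
Proof.
move=> CM su; have Cu j := smooth_coord_C1 j su.
rewrite (_ : (fun x => _) = (fun x =>
  \sum_j partial j (fun y => M y 0 i * u y 0 j) x
  + \sum_j M x 0 j * partial i (fun y => u y 0 j) x)); last first.
  by apply/funext => x; rewrite mxE.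
apply: rV_continuousD; apply: rV_continuous_sum => j.
  by apply: C1_partial; exact: C1M.
by apply: rV_continuousM; [exact: C1_continuous|exact: C1_partial].
Qed.

(* Both sides differ by [\sum_(i, j) 'd_j (m_i u^j phi^i)]. *)
Lemma integral_lie_bracket (M u : 'rV[R]_n -> 'rV[R]_n) :
  (forall i, C1 (fun x => M x 0 i)) -> smooth u ->
  integralRn (fun x => dot (M x) (lie_bracket phi u x)) =
  integralRn (fun x => dot (phi x) (ad_star u M x)).
Proof.
move=> CM su; have Cu i := smooth_coord_C1 i su.
have Cphi i := (test_fun_coord i tphi).2.
pose F i j := fun x => (M x 0 i * u x 0 j) * phi x 0 i.
have CMu i j : C1 (fun x => M x 0 i * u x 0 j) by exact: C1M.
have CF i j : C1 (F i j) by exact: C1M.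
have sF i j : exists K, supported_in K (F i j).
  have [_ [K phiK]] := (test_fun_coord i tphi).1.
  by exists K => x /phiK; rewrite /F => ->; rewrite mulr0.
pose D := fun x => \sum_i \sum_j partial j (F i j) x.
have HD i j : Cc (partial j (F i j)) /\ integralRn (partial j (F i j)) = 0.
  exact: Cc_integral_derive.
have CD : Cc D.
  by apply: Cc_sum => i; apply: Cc_sum => j; have [] := HD i j.
have ID : integralRn D = 0.
  rewrite Cc_integral_sum => [|i]; last by apply: Cc_sum => j; have [] := HD i j.
  rewrite big1// => i _; rewrite Cc_integral_sum => [|j]; last by have [] := HD i j.
  by rewrite big1// => j _; have [] := HD i j.
have cadj i := @ad_star_continuous M u i CM su.
rewrite -[RHS]subr0 -ID -Cc_integralB//; last exact: Cc_dot.
congr integralRn; apply/funext => x; apply/eqP; rewrite -subr_eq0; apply/eqP.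
(* Once the divergence is expanded, the terms with derivatives of [phi] and of the products
   [m_i u^j] cancel; the remaining double sum vanishes on exchanging [i] and [j] in one half. *)
transitivity (\sum_i \sum_j (M x 0 i * (phi x 0 j * partial j (fun y => u y 0 i) x)
   - phi x 0 i * (M x 0 j * partial i (fun y => u y 0 j) x))).
  rewrite /dot /D -!sumrB; apply: eq_bigr => i _.
  rewrite !mxE mulrDr !mulr_sumr opprB -!big_split/= addrC.
  rewrite -sumrB -big_split/=; apply: eq_bigr => j _.
  rewrite /partial (derive_mul _ _ (CMu i j) (Cphi i)); ring.
under eq_bigr do rewrite sumrB.
rewrite sumrB [X in _ - X]exchange_big/= -sumrB big1// => i _.
by rewrite -sumrB big1// => j _; ring.
Qed.

(** Pointwise, [rho u . grad chi] is the divergence of [rho chi u] minus [chi] times that of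
    [rho u]; the first divergence has compact support and integrates to 0. *)
Lemma integral_lie_fun (u : 'rV[R]_n -> 'rV[R]_n) (rho : 'rV[R]_n -> R) :
  C1 rho -> smooth u ->
  integralRn (fun x => rho x * lie_fun u chi x) =
  - integralRn (fun x => chi x * lie_dens u rho x).
Proof.
move=> Crho su; have Cu i := smooth_coord_C1 i su.
have Cchi : C1 chi by have [/smooth_C1] := tchi.
pose F j := fun x => (rho x * u x 0 j) * chi x.
have Cru j : C1 (fun x => rho x * u x 0 j) by exact: C1M.
have CF j : C1 (F j) by exact: C1M.
have sF j : exists K, supported_in K (F j).
  have [_ [K chiK]] := test_fun_Cc tchi.
  by exists K => x /chiK; rewrite /F => ->; rewrite mulr0.
have HD j : Cc (partial j (F j)) /\ integralRn (partial j (F j)) = 0.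
  exact: Cc_integral_derive.
pose D := fun x => \sum_j partial j (F j) x.
have CD : Cc D by apply: Cc_sum => j; have [] := HD j.
have ID : integralRn D = 0.
  rewrite Cc_integral_sum => [|j]; last by have [] := HD j.
  by rewrite big1// => j _; have [] := HD j.
rewrite -[RHS]add0r -ID -Cc_integralB//; last first.
  apply: (CcMr (test_fun_Cc tchi)); apply: rV_continuous_sum => j.
  exact: C1_partial.
congr integralRn; apply/funext => x.
rewrite /D /lie_fun /lie_dens /dot !mulr_sumr -sumrB; apply: eq_bigr => j _.
by rewrite mxE /partial (derive_mul _ _ (Cru j) Cchi); ring.
Qed.

(** The term in [grad a] is already the pairing of [phi] with the diamond; the other two need
    integration by parts to free [phi] and [chi] from derivatives. The minus sign before [lie_dens]
    comes from that of [integral_lie_fun]. *)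
Lemma bracket_linear (upper : bool) (H : functional)
    (M : 'rV[R]_n -> 'rV[R]_n) (rho : 'rV[R]_n -> R) :
  (forall i, C1 (fun x => M x 0 i)) -> C1 rho ->
  bracket upper (linear_functional phi chi) H M rho =
  weak (fun x => pm upper *: ad_star (Defs.derivM H M rho) M x
                 - pm upper *: diamond (derivrho H M rho) rho x)
       (fun x => - pm upper * lie_dens (Defs.derivM H M rho) rho x).
Proof.
move=> CM Crho; rewrite /bracket derivM_linear// derivrho_linear//.
have su := derivM_smooth H M rho; have sa := derivrho_smooth H M rho.
move: (Defs.derivM H M rho) (derivrho H M rho) su sa => u a su sa.
rewrite integral_lie_bracket//.
have Ca := smooth_C1 sa.
have Cdiamond : Cc (fun x => dot (phi x) (diamond a rho x)).
  apply: Cc_dot => // i.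
  rewrite (_ : (fun x => _) = fun x => rho x * partial i a x); last first.
    by apply/funext => x; rewrite !mxE.
  by apply: rV_continuousM; [exact: C1_continuous|exact: C1_partial].
have Clie : Cc (fun x => rho x * lie_fun u chi x).
  apply: CcMl; first exact: C1_continuous.
  rewrite (_ : lie_fun u chi = fun x => \sum_j u x 0 j * partial j chi x).
    apply: Cc_sum => j; apply: CcMl; first exact: smooth_coord_continuous.
    have [_ chiK] := test_fun_Cc tchi.
    by apply: (Cc_integral_derive _ _ chiK).1; apply: smooth_C1; case: tchi.
  by apply/funext => x; apply: eq_bigr => j _; rewrite mxE.
have Cdens : Cc (fun x => chi x * lie_dens u rho x).
  apply: (CcMr (test_fun_Cc tchi)); apply: rV_continuous_sum => j.
  by apply: C1_partial; apply: C1M => //; exact: smooth_coord_C1.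
have Cad : Cc (fun x => dot (phi x) (ad_star u M x)).
  by apply: Cc_dot => // i; exact: ad_star_continuous.
have CcZ c f : Cc f -> Cc (fun x => c * f x).
  by move=> Cf; apply: CcMl => //; exact: cst_continuous.
rewrite (_ : (fun x => rho x * _) =
  fun x => dot (phi x) (diamond a rho x) - rho x * lie_fun u chi x).
  rewrite Cc_integralB// integral_lie_fun// /weak.
  rewrite (_ : (fun x => dot _ _ + _) = (fun x =>
     (pm upper * dot (phi x) (ad_star u M x)
      - pm upper * dot (phi x) (diamond a rho x))
     + (- pm upper) * (chi x * lie_dens u rho x))).
    rewrite Cc_integralD; [|by apply: CcB; exact: CcZ|exact: CcZ].
    rewrite Cc_integralB; [|exact: CcZ..].
    by rewrite !Cc_integralZ//; ring.
  apply/funext => x; congr (_ + _); last by ring.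
  rewrite /dot !mulr_sumr -sumrB; apply: eq_bigr => i _; rewrite !mxE; ring.
apply/funext => x; rewrite mulrBr; congr (_ - _).
rewrite /lie_fun /dot mulr_sumr; apply: eq_bigr => i _; rewrite !mxE; ring.
Qed.

End WeakForm.

Section Main.
Context {R : realType} {n : nat}.

(** Testing with [chi = 0], then with [phi = 0], decouples the two components. *)
Lemma weak_inj (A A' : 'rV[R]_n -> 'rV[R]_n) (B B' : 'rV[R]_n -> R) :
  (forall i, continuous (fun x => A x 0 i)) ->
  (forall i, continuous (fun x => A' x 0 i)) ->
  continuous B -> continuous B' ->
  (forall phi chi, test_fun phi -> test_fun chi ->
     weak phi chi A B = weak phi chi A' B') ->
  A = A' /\ B = B'.
Proof.
move=> cA cA' cB cB' AB.
have cN (f : 'rV[R]_n -> R) : continuous f -> continuous (fun x => - f x).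
  by move=> cf x; exact: (cvgN (cf x)).
split; apply/funext => x; apply/eqP; rewrite -subr_eq0; apply/eqP; move: x.
- apply: (du_bois_reymond_rV (u := fun x => A x - A' x)) => [i|phi tphi].
    rewrite (_ : (fun x => _) = fun x => A x 0 i + - A' x 0 i).
      by apply: rV_continuousD => //; exact: cN.
    by apply/funext => x; rewrite !mxE.
  have := AB phi (fun=> 0) tphi (@test_fun0 R n _).
  rewrite /weak; under eq_fun do rewrite mul0r addr0.
  under [in RHS]eq_fun do rewrite mul0r addr0.
  move/eqP; rewrite -subr_eq0 -Cc_integralB; [|exact: Cc_dot..] => /eqP <-.
  congr integralRn; apply/funext => x; rewrite /dot -sumrB.
  by apply: eq_bigr => i _; rewrite !mxE mulrBr.
- apply: (du_bois_reymond (h := fun x => B x - B' x)) => [|chi tchi].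
    by apply: rV_continuousD => //; exact: cN.
  have := AB (fun=> 0) chi (@test_fun0 R n _) tchi.
  have dot0 (u : 'rV[R]_n) : dot 0 u = 0.
    by rewrite /dot big1// => i _; rewrite mxE mul0r.
  rewrite /weak; under eq_fun do rewrite dot0 add0r.
  under [in RHS]eq_fun do rewrite dot0 add0r.
  have Cchi := test_fun_Cc tchi.
  move/eqP; rewrite -subr_eq0 -Cc_integralB; [|exact: CcMr..] => /eqP <-.
  by congr integralRn; apply/funext => x; rewrite mulrBr.
Qed.

End Main.

Theorem proposition3p6 (R : realType) (n : nat) (nu : R) (upper : bool)
  (J : set R) (M : R -> 'rV[R]_n -> 'rV[R]_n) (rho : R -> 'rV[R]_n -> R)
  (J_open : open J) (J_itv : is_interval J)
  (M_smooth : smooth_on (J `*` setT)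
     (fun p : (R^o * 'rV[R]_n)%type => M p.1 p.2))
  (rho_smooth : smooth_on (J `*` setT)
     (fun p : (R^o * 'rV[R]_n)%type => rho p.1 p.2 : R^o))
  (rho_gt0 : forall (t : R) (x : 'rV[R]_n), J t -> 0 < rho t x) :
  bracket_dynamics upper (hamiltonian nu) J M rho <->
  lie_poisson_form upper (hamiltonian nu) J M rho.
Proof.
move: (hamiltonian nu) => H.
have CM t i : J t -> C1 (fun x => M t x 0 i).
  move=> Jt; apply: coord_C1 => [x|v]; first exact: (differentiable_space M_smooth).
  exact: (continuous_space_derive M_smooth).
have Crho t : J t -> C1 (rho t).
  move=> Jt; split=> [x|v]; first exact: (differentiable_space rho_smooth).
  exact: (continuous_space_derive rho_smooth).
pose A t x := pm upper *: ad_star (Defs.derivM H (M t) (rho t)) (M t) x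
  - pm upper *: diamond (derivrho H (M t) (rho t)) (rho t) x.
pose B t x := - pm upper * lie_dens (Defs.derivM H (M t) (rho t)) (rho t) x.
have cA t i : J t -> continuous (fun x => A t x 0 i).
  move=> Jt; have su := derivM_smooth H (M t) (rho t).
  have sa := derivrho_smooth H (M t) (rho t).
  rewrite (_ : (fun x => _) = fun x =>
    pm upper * ad_star (Defs.derivM H (M t) (rho t)) (M t) x 0 i +
    - pm upper * (rho t x * partial i (derivrho H (M t) (rho t)) x)).
    apply: rV_continuousD; apply: rV_continuousM; try exact: cst_continuous.
      by apply: ad_star_continuous => // j; exact: CM.
    apply: rV_continuousM; first by apply: C1_continuous; exact: Crho.
    by apply: C1_partial; exact: smooth_C1.
  by apply/funext => x; rewrite /A !mxE mulNr.
have cB t : J t -> continuous (B t).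
  move=> Jt; apply: rV_continuousM; first exact: cst_continuous.
  apply: rV_continuous_sum => j; apply: C1_partial.
  by apply: C1M; [exact: Crho|apply: smooth_coord_C1; exact: derivM_smooth].
have evol t phi chi : J t -> test_fun phi -> test_fun chi ->
  is_derive t (1 : R)
    (fun s => evalF (linear_functional phi chi) (M s) (rho s))
    (weak phi chi (time_derive M t) (time_derive (rho : R -> 'rV[R]_n -> R^o) t)).
  by move=> Jt tphi tchi; exact: (is_derive_evalF_linear tphi tchi J_open Jt).
have bracketE t phi chi : J t -> test_fun phi -> test_fun chi ->
    bracket upper (linear_functional phi chi) H (M t) (rho t) =
    weak phi chi (A t) (B t).
  move=> Jt tphi tchi; apply: bracket_linear => //; last exact: Crho.
  by move=> i; exact: CM.
split=> [dyn t Jt|lpf phi chi tphi tchi t Jt].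
(* The dynamics and [evol] give two values for the derivative of the same function of time, so the
   weak forms agree for all test pairs. *)
- have [|||||AE BE] := @weak_inj R n (time_derive M t) (A t)
    (time_derive (rho : R -> 'rV[R]_n -> R^o) t) (B t).
  + move=> i x; apply: (cvg_comp (time_derive M t) (fun y : 'rV[R]_n => y 0 i)).
      exact: (continuous_time_derive_space M_smooth Jt).
    exact: coord_continuous.
  + by move=> i; exact: cA.
  + exact: (continuous_time_derive_space rho_smooth Jt).
  + exact: cB.
  + move=> phi chi tphi tchi; rewrite -bracketE//.
    have [_ <-] := dyn phi chi tphi tchi t Jt.
    by have [_ <-] := evol t phi chi Jt tphi tchi.
  move=> x; split.
    by rewrite -/(A t x) -AE; exact: (is_derive_time M_smooth).
  by rewrite -/(B t x) -BE; exact: (is_derive_time rho_smooth).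
(* Conversely, uniqueness of the derivative at each fixed [x] identifies [A t] and [B t] with the
   time derivatives, and [evol] concludes. *)
- rewrite bracketE//.
  have -> : A t = time_derive M t.
    apply/funext => x; have [[_ AE] _] := lpf t Jt x; rewrite /A -AE.
    by have [_ <-] := is_derive_time M_smooth x Jt.
  have -> : B t = time_derive (rho : R -> 'rV[R]_n -> R^o) t.
    apply/funext => x; have [_ [_ BE]] := lpf t Jt x; rewrite /B -BE.
    by have [_ <-] := is_derive_time rho_smooth x Jt.
  exact: evol.
Qed.
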